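(* Let $U$ be an optimal prefix-free machine, and let $T$ be a computable real with $0<T<1$. Put $Z(T)=\sum_{p\in\operatorname{dom}U}2^{-|p|/T}$. Then $Z(T)$ and $\operatorname{dom}U$ are weak truth-table equivalent, i.e. $Z(T)\le_{wtt}\operatorname{dom}U$ and $\operatorname{dom}U\le_{wtt}Z(T)$, where $Z(T)$ is identified with the set of positions of the ones in its base-two expansion.
   Context: $\{0,1\}^*$ is the set of finite binary strings and $|p|$ denotes the length of $p$. A prefix-free machine is a partial recursive function $F\colon\{0,1\}^*\to\{0,1\}^*$ whose domain $\operatorname{dom}F$ is prefix-free (no string in it is a prefix of another string in it). A prefix-free machine $U$ is optimal if for each prefix-free machine $F$ there exists $d\in\mathbb{N}$ such that for every $p\in\operatorname{dom}F$ there is $q\in\operatorname{dom}U$ with $U(q)=F(p)$ and $|q|\le|p|+d$. For $0<T\le1$ the sum defining $Z(T)$ converges and $0<Z(T)<1$. A real $\alpha$ is computable if there is a computable sequence $\{a_n\}_{n\in\mathbb{N}}$ of rationals with $|\alpha-a_n|<2^{-n}$ for all $n\in\mathbb{N}$. For $A,B\subset\mathbb{N}$, $A\le_{wtt}B$ means that there exist an oracle Turing machine $M$ and a total recursive function $g\colon\mathbb{N}\to\mathbb{N}$ such that $A$ is Turing reducible to $B$ via $M$ and, on every input $n\in\mathbb{N}$, $M$ only queries natural numbers at most $g(n)$. Strings are identified with natural numbers via the length-then-lexicographic order $\lambda,0,1,00,01,10,11,000,\dots$ (i.e. $s\mapsto 1s-1$, with $1s$ read as a binary integer), so $\operatorname{dom}U$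 is regarded as a subset of $\mathbb{N}$. A real in $(0,1)$ is regarded as the subset of $\mathbb{N}$ consisting of the positions at which its base-two expansion (with infinitely many zeros) has the digit $1$. *)

(* Defs.v *)
From HB Require Import structures.
From mathcomp Require Import all_boot all_order all_algebra.
From mathcomp Require Import all_classical all_reals all_analysis.

Set Implicit Arguments.
Unset Strict Implicit.
Unset Printing Implicit Defensive.

Import Order.TTheory GRing.Theory Num.Theory.
Import numFieldNormedType.Exports.

Local Open Scope classical_set_scope.

(* A partial function from nat^n to nat is represented by its graph. *)
Definition pfun (n : nat) := n.-tuple nat -> nat -> Prop.

Definition zero_pfun (n : nat) : pfun n := fun _ y => y = 0.

Definition succ_pfun : pfun 1 := fun v y => y = (thead v).+1.

Definition proj_pfun (n : nat) (i : 'I_n) : pfun n := fun v y => y = tnth v i.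

Definition comp_pfun (m n : nat) (g : pfun m) (h : 'I_m -> pfun n) : pfun n :=
  fun v y => exists w : m.-tuple nat,
    (forall i, h i v (tnth w i)) /\ g w y.

(* f (0, v) = g v and f (i + 1, v) = h (i, f (i, v), v); t i is f (i, v). *)
Definition primrec_pfun (n : nat) (g : pfun n) (h : pfun n.+2) : pfun n.+1 :=
  fun v y => exists t : nat -> nat,
    [/\ g [tuple of behead v] (t 0),
        forall i, i < thead v -> h [tuple of i :: t i :: behead v] (t i.+1)
      & y = t (thead v)].

(* The least y with f (y, v) = 0, provided f (z, v) is defined for all z < y. *)
Definition min_pfun (n : nat) (f : pfun n.+1) : pfun n :=
  fun v y => f [tuple of y :: v] 0 /\
    forall z, z < y -> exists k, f [tuple of z :: v] k.+1.

Inductive partial_recursive : forall n : nat, pfun n -> Prop :=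
| partial_recursive_zero n : partial_recursive (@zero_pfun n)
| partial_recursive_succ : partial_recursive succ_pfun
| partial_recursive_proj n (i : 'I_n) : partial_recursive (proj_pfun i)
| partial_recursive_comp m n (g : pfun m) (h : 'I_m -> pfun n) :
    partial_recursive g -> (forall i, partial_recursive (h i)) ->
    partial_recursive (comp_pfun g h)
| partial_recursive_primrec n (g : pfun n) (h : pfun n.+2) :
    partial_recursive g -> partial_recursive h ->
    partial_recursive (primrec_pfun g h)
| partial_recursive_min n (f : pfun n.+1) :
    partial_recursive f -> partial_recursive (min_pfun f).

Definition total_recursive (g : nat -> nat) : Prop :=
  partial_recursive (fun (v : 1.-tuple nat) y => y = g (thead v)).

(* The rank of s in the length-then-lexicographic order: read 1s in binary and
   subtract 1. *)
Definition nat_of_string (s : seq bool) : nat :=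
  (foldl (fun (a : nat) (b : bool) => a.*2 + b) 1 s).-1.

(* A partial function on strings is a total function to an option type, None
   meaning undefined. *)
Definition string_pfun := seq bool -> option (seq bool).

Definition dom (F : string_pfun) : set (seq bool) := [set p | isSome (F p)].

Definition partial_recursive_string (F : string_pfun) : Prop :=
  exists2 f : pfun 1, partial_recursive f &
    forall n m, f [tuple n] m <->
      exists p q, [/\ n = nat_of_string p, m = nat_of_string q & F p = Some q].

Definition prefix_free (A : set (seq bool)) : Prop :=
  forall p q, A p -> A q -> prefix p q -> p = q.

Definition prefix_free_machine (F : string_pfun) : Prop :=
  partial_recursive_string F /\ prefix_free (dom F).

Definition optimal (U : string_pfun) : Prop :=
  prefix_free_machine U /\
  forall F, prefix_free_machine F ->
    exists d : nat, forall p, dom F p ->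
      exists q, [/\ dom U q, U q = F p & size q <= size p + d].

Definition string_set_nat (A : set (seq bool)) : set nat := nat_of_string @` A.

Inductive move := MoveLeft | MoveRight | Stay.

(* A tape (l, r) carries rev l ++ r, all other cells being blank; the head is on
   the first cell of r. *)
Definition tape (Sigma : Type) : Type := (seq Sigma * seq Sigma)%type.

Definition tape_read (Sigma : Type) (blank : Sigma) (t : tape Sigma) : Sigma :=
  head blank t.2.

Definition tape_write (Sigma : Type) (a : Sigma) (t : tape Sigma) :
    tape Sigma := (t.1, a :: behead t.2).

Definition tape_move (Sigma : Type) (blank : Sigma) (d : move)
    (t : tape Sigma) : tape Sigma :=
  match d with
  | MoveLeft => (behead t.1, head blank t.1 :: t.2)
  | MoveRight => (head blank t.2 :: t.1, behead t.2)
  | Stay => t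
  end.

(* The number written in unary on a tape: the number of consecutive ones from
   the head on, rightwards. *)
Definition tape_number (Sigma : eqType) (one : Sigma) (t : tape Sigma) : nat :=
  find (predC1 one) t.2.

(* What a machine does in a given state: halt with a yes/no answer, query the
   oracle and branch on its answer, or perform an ordinary transition. *)
Inductive action (Q Sigma : finType) (k : nat) : Type :=
| Halt of bool
| Query (yes no : Q)
| Work of (k.-tuple Sigma -> Q * k.-tuple (Sigma * move)).

Arguments Halt {Q Sigma k}.
Arguments Query {Q Sigma k}.
Arguments Work {Q Sigma k}.

Record oracle_machine := OracleMachine {
  om_tapes : nat;
  om_input : 'I_om_tapes;
  om_query : 'I_om_tapes;
  om_state : finType;
  om_symbol : finType;
  om_blank : om_symbol;
  om_one : om_symbol;
  om_one_neq_blank : om_one != om_blank;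
  om_start : om_state;
  om_action : om_state -> action om_state om_symbol om_tapes
}.

Record config (M : oracle_machine) := Config {
  cf_state : om_state M;
  cf_tapes : (om_tapes M).-tuple (tape (om_symbol M))
}.

(* All tapes are blank, except that n is written in unary on the input tape. *)
Definition init_config (M : oracle_machine) (n : nat) : config M :=
  Config (om_start M)
    [tuple (if i == om_input M then ([::], nseq n (om_one M))
            else ([::], [::])) | i < om_tapes M].

Definition query_number (M : oracle_machine) (c : config M) : nat :=
  tape_number (om_one M) (tnth (cf_tapes c) (om_query M)).

Definition step (M : oracle_machine) (B : set nat) (c : config M) : config M :=
  match om_action (cf_state c) with
  | Halt _ => c
  | Query yes no =>
      Config (if query_number c \in B then yes else no) (cf_tapes c)
  | Work delta =>
      let: (q, acts) :=
        delta [tuple of map (tape_read (om_blank M)) (cf_tapes c)] in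
      Config q
        [tuple tape_move (om_blank M) (tnth acts i).2
                 (tape_write (tnth acts i).1 (tnth (cf_tapes c) i))
        | i < om_tapes M]
  end.

Definition run (M : oracle_machine) (B : set nat) (n t : nat) : config M :=
  iter t (step B) (init_config M n).

Definition turing_reducible_via (M : oracle_machine) (A B : set nat) : Prop :=
  forall n, exists t,
    om_action (cf_state (run M B n t)) = Halt (n \in A).

Definition queries_at_most (M : oracle_machine) (B : set nat) (g : nat -> nat) :
    Prop :=
  forall n t yes no,
    om_action (cf_state (run M B n t)) = Query yes no ->
    query_number (run M B n t) <= g n.

Definition wtt_reducible (A B : set nat) : Prop :=
  exists M : oracle_machine, exists g : nat -> nat,
    [/\ total_recursive g, turing_reducible_via M A B
      & queries_at_most M B g].

Local Open Scope ring_scope.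

Definition computable_rat_seq (a : nat -> rat) : Prop :=
  exists s p q : nat -> nat,
    [/\ total_recursive s, total_recursive p, total_recursive q,
        (forall n, q n != 0%N)
      & forall n, a n = (-1) ^+ s n * (p n)%:R / (q n)%:R].

Definition computable_real (R : realType) (x : R) : Prop :=
  exists2 a : nat -> rat, computable_rat_seq a &
    forall n, `|x - ratr (a n)| < 2 ^- n.

(* A is the set of positions of the ones in a base-two expansion of x with
   infinitely many zeros; positions are counted from 0, so that position n has
   weight 2^-(n+1). *)
Definition base_two_expansion (R : realType) (x : R) (A : set nat) : Prop :=
  (fun N : nat => \sum_(0 <= n < N) (n \in A)%:R / 2 ^+ n.+1 : R) @ \oo --> x
  /\ forall n, exists2 m, (n <= m)%N & ~ A m.

(* For 0 <= x < 1 there is exactly one such expansion; set0 is a junk value for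
   other x. *)
Definition real_set (R : realType) (x : R) : set nat :=
  xget set0 (base_two_expansion x).

(* \esum is extended-real valued; fine is harmless because the sum is finite
   for prefix-free dom U and 0 < T <= 1. *)
Definition Zsum (R : realType) (U : string_pfun) (T : R) : R :=
  fine (\esum_(p in dom U) (2 `^ (- (size p)%:R / T))%:E).

(* Main.v *)
Require Import Defs.
From mathcomp Require Import all_boot all_order all_algebra.
From mathcomp Require Import all_classical all_reals all_analysis.
From mathcomp Require Import zify ring lra.

Set Implicit Arguments.
Unset Strict Implicit.
Unset Printing Implicit Defensive.

Import Order.TTheory GRing.Theory Num.Theory.
Import numFieldNormedType.Exports.

(** Write w(l) = 2^(-l/T) for the weight of a string of length l and Z for the
    sum Z(T). The domain of U is enumerated by stages; at stage s, the strings
    found so far, with rational lower bounds of their weights, give a computable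
    lower bound [Zlow s / 2 ^ s] of Z, and these bounds come arbitrarily close
    to Z ([Zlow_cofinal]).

    From Z to the domain. If a string of the domain is missing at stage s, then Z
    exceeds the lower bound of stage s by at least the weight of that string
    ([Zlow_missing]). The weights are bounded below by 2^(-k l) for some k, so
    for a string of length l it is enough to wait for a stage whose lower bound
    agrees with the first k l + 1 bits of Z up to one unit in the last place: the
    string is in the domain if and only if it has been found by then.

    From the domain to Z. Since T < 1, the weights are at most 2^(-l) 2^(-m) for
    l >= k' m, so by Kraft's inequality the strings of length at least k' m
    contribute at most 2^(-m) to Z ([Zpartial_tail]). A computable finite part of
    the domain therefore determines Z up to any prescribed error. To read off the
    bits of Z, and with a bound on the part of the domain that is consulted, one
    needs a computable margin by which Z stays away from the dyadic rationals.
    This is where optimality enters ([dyadic_gap]). Suppose that Z is too close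
    to the N-th dyadic rational r. The first stage s at which the lower bound is
    close to r is computable from N, so a prefix-free machine can send the string
    0^N 1 to the string numbered s, and hence U has this value at a string p of
    length at most N + d. But stages are arranged to exceed the values that U
    takes at the strings found by them, so p is missing at stage s, and Z exceeds
    the lower bound by the weight of p, at least 2^(-k (N + d)), which contradicts
    the closeness of both to r.

    Computability. Both reductions have the same form: the segment of the oracle
    below g(n) is read into a number, and a partial recursive function, an
    unbounded search that succeeds on this number, is applied to it and n.
    [wtt_reducible_of_segment] realizes this by an oracle machine. Partial
    recursive functions are translated into programs on registers
    ([partial_recursive_implementable]), and these into machines that keep every
    register in unary on a tape of its own ([reach_exec]). The stages of the
    enumeration come from a step-bounded form of partial recursive functions
    ([normal_form]). *)

(** * Total recursive functions of several arguments *)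

(** The arguments of a total function are passed as a list, read with the
    default value 0, so that adding a variable in front of an environment (as
    primitive recursion and bounded sums do) is plain consing. *)
Definition rec n (f : seq nat -> nat) : Prop :=
  partial_recursive (fun (v : n.-tuple nat) y => y = f v).

Lemma partial_recursive_ext n (f f' : pfun n) :
  (forall v y, f v y <-> f' v y) -> partial_recursive f -> partial_recursive f'.
Proof.
move=> ff'; suff -> : f = f' by [].
by apply/funext => v; apply/funext => y; apply/propext.
Qed.

Lemma rec_ext n (f f' : seq nat -> nat) : (forall v : n.-tuple nat, f v = f' v) ->
  rec n f -> rec n f'.
Proof. by move=> ff'; apply: partial_recursive_ext => v y; rewrite ff'. Qed.

Lemma map_nth_behead k n (v : (k + n).-tuple nat) :
  [seq nth 0 v i | i <- iota k n] = iter k behead v.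
Proof.
have -> : iter k behead v = drop k v.
  elim: k {v} (tval v) => [|k IHk] s; first by rewrite drop0.
  by rewrite iterSr IHk; case: s.
have := @map_nth_iota _ 0 v k n; rewrite size_tuple addKn => /(_ (leqnn n)) ->.
by rewrite take_oversize // size_drop size_tuple addKn.
Qed.

Lemma rec_nth n i : i < n -> rec n (fun v => nth 0 v i).
Proof.
move=> lt_in; apply: partial_recursive_ext (partial_recursive_proj (Ordinal lt_in)).
by move=> v y; rewrite /proj_pfun (tnth_nth 0).
Qed.

Definition evals (hs : seq (seq nat -> nat)) (v : seq nat) : seq nat :=
  [seq h v | h <- hs].

Lemma rec_comp n g hs : rec (size hs) g ->
  (forall i : 'I_(size hs), rec n (nth (fun=> 0) hs i)) ->
  rec n (fun v => g (evals hs v)).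
Proof.
move=> rg rh; apply: partial_recursive_ext (partial_recursive_comp rg rh) => v y.
have Ew (w : (size hs).-tuple nat) :
    (forall i, tnth w i = nth (fun=> 0) hs i v) <->
    (tval w = evals hs v).
  split=> [Ew|Ew i]; last first.
    by rewrite (tnth_nth 0) Ew (nth_map (fun=> 0)).
  apply: (@eq_from_nth _ 0) => [|i]; first by rewrite size_map size_tuple.
  rewrite size_tuple => lt_i; rewrite (nth_map (fun=> 0)) //.
  by rewrite -(Ew (Ordinal lt_i)) (tnth_nth 0).
split=> [[w [/Ew -> ->]] //|->].
by exists (map_tuple (fun h : seq nat -> nat => h v) (in_tuple hs)); split=> //; apply/Ew.
Qed.

Lemma rec_app1 n (F : nat -> nat) a : rec 1 (fun v => F (nth 0 v 0)) ->
  rec n a -> rec n (fun v => F (a v)).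
Proof.
move=> rF ra; apply: (@rec_comp n _ [:: a] rF).
by case=> [[|i] //= _]; exact: ra.
Qed.

Lemma rec_app2 n (F : nat -> nat -> nat) a b :
  rec 2 (fun v => F (nth 0 v 0) (nth 0 v 1)) ->
  rec n a -> rec n b -> rec n (fun v => F (a v) (b v)).
Proof.
move=> rF ra rb; apply: (@rec_comp n _ [:: a; b] rF).
by case=> [[|[|i]] //= _].
Qed.

Lemma rec_app3 n (F : nat -> nat -> nat -> nat) a b c :
  rec 3 (fun v => F (nth 0 v 0) (nth 0 v 1) (nth 0 v 2)) ->
  rec n a -> rec n b -> rec n c -> rec n (fun v => F (a v) (b v) (c v)).
Proof.
move=> rF ra rb rc; apply: (@rec_comp n _ [:: a; b; c] rF).
by case=> [[|[|[|i]]] //= _].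
Qed.

Lemma rec_subst n m f (s : seq nat) : rec m f -> size s = m ->
  all (ltn^~ n) s -> rec n (fun v => f [seq nth 0 v i | i <- s]).
Proof.
move=> rf sz_s /allP lts.
have := @rec_comp n f [seq (fun v => nth 0 v i) | i <- s].
rewrite size_map sz_s => /(_ rf) => rc.
apply: rec_ext (rc _) => [v|i]; first by rewrite /evals -map_comp.
rewrite (nth_map 0) ?sz_s //; apply: rec_nth.
by apply: lts; rewrite mem_nth // sz_s.
Qed.

(** Every change of environment below replaces the first [k] variables by a list
    of variables and keeps the remaining ones. *)
Lemma rec_subst_behead n k f (s : seq nat) : rec (size s + n) f ->
  all (ltn^~ (k + n)) s ->
  rec (k + n) (fun v => f ([seq nth 0 v i | i <- s] ++ iter k behead v)).
Proof.
move=> rf lts; have := rec_subst (n := k + n) (s := s ++ iota k n) rf.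
rewrite size_cat size_iota all_cat lts => /(_ erefl).
have -> : all (ltn^~ (k + n)) (iota k n).
  by apply/allP => i; rewrite mem_iota => /andP[].
by move=> /(_ isT); apply: rec_ext => v; rewrite map_cat map_nth_behead.
Qed.

Lemma rec_behead n f : rec n f -> rec n.+1 (fun v => f (behead v)).
Proof. by move=> rf; exact: (@rec_subst_behead n 1 f [::] rf). Qed.

Lemma rec_succ n a : rec n a -> rec n (fun v => (a v).+1).
Proof.
apply: (rec_app1 (F := succn)).
apply: partial_recursive_ext partial_recursive_succ => v y.
by rewrite /succ_pfun; case/tupleP: v => x v.
Qed.

Lemma rec_const n c : rec n (fun=> c).
Proof. by elim: c => [|c /rec_succ //]; exact: partial_recursive_zero. Qed.

(** [primrec_pfun] recurses on its first argument; substituting [k] for it gives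
    a number of rounds that depends on all arguments. *)
Lemma rec_iteri n k g (h : nat -> nat -> seq nat -> nat) :
  rec n k -> rec n g ->
  rec n.+2 (fun v => h (nth 0 v 0) (nth 0 v 1) (behead (behead v))) ->
  rec n (fun v => iteri (k v) (fun i x => h i x v) (g v)).
Proof.
move=> rk rg rh.
suff rp : rec n.+1 (fun v => iteri (nth 0 v 0)
    (fun i x => h i x (behead v)) (g (behead v))).
  pose hs := k :: [seq (fun v => nth 0 v i) | i <- iota 0 n].
  have sz_hs : size hs = n.+1 by rewrite /= size_map size_iota.
  have := @rec_comp n _ hs; rewrite sz_hs => /(_ _ rp) rc.
  apply: rec_ext (rc _) => [v|[[|i] lt_i] //=].
    rewrite /=; have -> : evals [seq (nth 0)^~ i | i <- iota 0 n] v = v; last by [].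
    by rewrite /evals -map_comp (@map_nth_behead 0 n).
  by rewrite (nth_map 0) ?size_iota // nth_iota //; exact: rec_nth.
apply: partial_recursive_ext (partial_recursive_primrec rg rh) => v y.
case/tupleP: v => k' v; rewrite /primrec_pfun theadE.
have -> : [tuple of behead [tuple of k' :: v]] = v by apply: val_inj.
rewrite /=; pose it i := iteri i (fun i x => h i x v) (g v).
rewrite -/(it k').
split=> [[t [t0 tS ->]]|->]; last by exists it.
suff Et i : i <= k' -> t i = it i by exact: Et.
elim: i => [|i IHi] //= lt_i.
by rewrite (tS i) // /it /= -/(it i) -IHi // ltnW.
Qed.

(** * Arithmetic *)

Lemma rec_add n a b : rec n a -> rec n b -> rec n (fun v => a v + b v).
Proof.
apply: (rec_app2 (F := addn)).
have := @rec_iteri 2 _ _ (fun _ x _ => x.+1) (rec_nth (isT : 0 < 2))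
  (rec_nth (isT : 1 < 2)) (rec_succ (rec_nth (isT : 1 < 4))).
apply: rec_ext => v; elim: (nth 0 v 0) => //= k ->; lia.
Qed.

Lemma rec_pred n a : rec n a -> rec n (fun v => (a v).-1).
Proof.
apply: (rec_app1 (F := predn)).
have := @rec_iteri 1 _ _ (fun i _ _ => i) (rec_nth (isT : 0 < 1))
  (rec_const 1 0) (rec_nth (isT : 0 < 3)).
by apply: rec_ext => v; case: (nth 0 v 0).
Qed.

Lemma rec_sub n a b : rec n a -> rec n b -> rec n (fun v => a v - b v).
Proof.
apply: (rec_app2 (F := subn)).
have := @rec_iteri 2 _ _ (fun _ x _ => x.-1) (rec_nth (isT : 1 < 2))
  (rec_nth (isT : 0 < 2)) (rec_pred (rec_nth (isT : 1 < 4))).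
apply: rec_ext => v; elim: (nth 0 v 1) => /= [|k ->]; lia.
Qed.

Lemma rec_mul n a b : rec n a -> rec n b -> rec n (fun v => a v * b v).
Proof.
apply: (rec_app2 (F := muln)).
have := @rec_iteri 2 _ _ (fun _ x v => x + nth 0 v 1) (rec_nth (isT : 0 < 2))
  (rec_const 2 0) (rec_add (rec_nth (isT : 1 < 4))
  (rec_behead (rec_behead (rec_nth (isT : 1 < 2))))).
apply: rec_ext => v; elim: (nth 0 v 0) => //= k ->; lia.
Qed.

Lemma rec_exp n a b : rec n a -> rec n b -> rec n (fun v => a v ^ b v).
Proof.
apply: (rec_app2 (F := expn)).
have := @rec_iteri 2 _ _ (fun _ x v => x * nth 0 v 0) (rec_nth (isT : 1 < 2))
  (rec_const 2 1) (rec_mul (rec_nth (isT : 1 < 4))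
  (rec_behead (rec_behead (rec_nth (isT : 0 < 2))))).
by apply: rec_ext => v; elim: (nth 0 v 1) => //= k ->; rewrite expnSr.
Qed.

Lemma rec_sum n k (F : nat -> seq nat -> nat) : rec n k ->
  rec n.+1 (fun v => F (nth 0 v 0) (behead v)) ->
  rec n (fun v => \sum_(0 <= i < k v) F i v).
Proof.
move=> rk rF.
have rF2 : rec n.+2 (fun v => F (nth 0 v 0) (behead (behead v))).
  exact: (@rec_subst_behead n 2 (fun v => F (nth 0 v 0) (behead v)) [:: 0] rF).
have := @rec_iteri n k (fun=> 0) (fun i x v => x + F i v) rk (rec_const n 0)
  (rec_add (rec_nth (isT : 1 < n.+2)) rF2).
apply: rec_ext => v; elim: (k v) => [|j IH]; first by rewrite big_nil.
by rewrite big_nat_recr //= IH.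
Qed.

Lemma rec_fixed_sum n (I : Type) (s : seq I) (F : I -> seq nat -> nat) :
  (forall i, rec n (F i)) -> rec n (fun v => \sum_(i <- s) F i v).
Proof.
move=> rF; elim: s => [|i s IHs].
  by apply: rec_ext (rec_const n 0) => v; rewrite big_nil.
by apply: rec_ext (rec_add (rF i) IHs) => v; rewrite big_cons.
Qed.

(** * Decidable predicates *)

Lemma rec_leq n a b : rec n a -> rec n b -> rec n (fun v => a v <= b v : nat).
Proof.
move=> ra rb; apply: rec_ext (rec_sub (rec_const n 1) (rec_sub ra rb)) => v; lia.
Qed.

Lemma rec_negb n (a : seq nat -> bool) :
  rec n (fun v => a v : nat) -> rec n (fun v => ~~ a v : nat).
Proof.
by move=> ra; apply: rec_ext (rec_sub (rec_const n 1) ra) => v; case: (a v).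
Qed.

Lemma rec_andb n (a b : seq nat -> bool) : rec n (fun v => a v : nat) ->
  rec n (fun v => b v : nat) -> rec n (fun v => a v && b v : nat).
Proof.
move=> ra rb; apply: rec_ext (rec_mul ra rb) => v.
by case: (a v); case: (b v).
Qed.

Lemma rec_eqn n a b : rec n a -> rec n b -> rec n (fun v => a v == b v : nat).
Proof.
move=> ra rb; apply: rec_ext (rec_andb (rec_leq ra rb) (rec_leq rb ra)) => v.
by rewrite eqn_leq.
Qed.

Lemma rec_odd n a : rec n a -> rec n (fun v => odd (a v) : nat).
Proof.
apply: (rec_app1 (F := fun x => nat_of_bool (odd x))).
have := @rec_iteri 1 _ _ (fun _ x _ => 1 - x) (rec_nth (isT : 0 < 1))
  (rec_const 1 0) (rec_sub (rec_const 3 1) (rec_nth (isT : 1 < 3))).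
by apply: rec_ext => v; elim: (nth 0 v 0) => //= k ->; case: (odd k).
Qed.

Lemma sum_ltn k N : k <= N -> \sum_(0 <= i < N) (i < k) = k.
Proof.
move=> le_kN; rewrite (big_cat_nat (n := k) (leq0n k) le_kN) /=.
rewrite (eq_big_nat _ _ (F2 := fun=> 1)) => [|i /andP[_ ->] //].
rewrite sum_nat_const_nat subn0 muln1 big_nat_cond big1 ?addn0 //.
by move=> i /andP[/andP[le_ki _] _]; rewrite ltnNge le_ki.
Qed.

(** Division as a bounded sum of comparisons, which makes it recursive. *)
Lemma divn_sum a b : 0 < b -> a %/ b = \sum_(0 <= i < a) (i.+1 * b <= a).
Proof.
move=> b_gt0; rewrite -[LHS](sum_ltn (leq_div a b)).
by apply: eq_bigr => i _; rewrite leq_divRL.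
Qed.

Lemma rec_div n a (b : seq nat -> nat) :
  (forall v : n.-tuple nat, 0 < b v) ->
  rec n a -> rec n b -> rec n (fun v => a v %/ b v).
Proof.
move=> b_gt0 ra rb.
apply: rec_ext (rec_sum (F := fun i v => i.+1 * b v <= a v : nat) ra _).
  by move=> v; rewrite divn_sum.
apply: rec_leq; last exact: rec_behead.
by apply: rec_mul; [apply/rec_succ/rec_nth | exact: rec_behead].
Qed.

Lemma total_recursiveP g : total_recursive g <-> rec 1 (fun v => g (nth 0 v 0)).
Proof.
by split; apply: partial_recursive_ext => v y; case/tupleP: v => x v.
Qed.

(** Proves recursiveness along the structure of an expression. The occurrences
    of [behead] in the goals stem from the variables bound by sums. *)
Ltac rec_step :=
  first [ assumption
  | match goal with
    | |- rec _ (fun v => nth 0 v _) => apply: rec_nth; exact: isT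
    | |- rec _ (fun v => nth 0 (behead v) ?j) =>
        refine (@rec_behead _ (fun w => nth 0 w j) _)
    | |- rec _ (fun v => nth 0 (behead (behead v)) ?j) =>
        refine (@rec_behead _ (fun w => nth 0 (behead w) j) _)
    | |- rec _ (fun v => nth 0 (behead (behead (behead v))) ?j) =>
        refine (@rec_behead _ (fun w => nth 0 (behead (behead w)) j) _)
    | |- rec _ (fun _ => ?c) => exact: rec_const
    | |- rec _ (fun v => nat_of_bool (_ <= _)) => apply: rec_leq
    | |- rec _ (fun v => nat_of_bool (_ == _)) => apply: rec_eqn
    | |- rec _ (fun v => nat_of_bool (_ && _)) => apply: rec_andb
    | |- rec _ (fun v => nat_of_bool (~~ _)) => apply: rec_negb
    | |- rec _ (fun v => nat_of_bool (odd _)) => apply: rec_odd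
    | |- rec _ (fun v => S _) => apply: rec_succ
    | |- rec _ (fun v => predn _) => apply: rec_pred
    | |- rec _ (fun v => addn _ _) => apply: rec_add
    | |- rec _ (fun v => subn _ _) => apply: rec_sub
    | |- rec _ (fun v => muln _ _) => apply: rec_mul
    | |- rec _ (fun v => expn _ _) => apply: rec_exp
    | |- rec _ (fun v => divn _ _) => apply: rec_div
    | |- rec _ (fun v => \sum_(0 <= i < _) _) => apply: rec_sum
    end ].
Ltac rec_tac := repeat (rec_step; rewrite /=).

Lemma ex_least (P : pred nat) : (exists s, P s) ->
  exists s, P s /\ forall z, z < s -> ~~ P z.
Proof.
move=> ex; have [s Ps min_s] := ex_minnP ex; exists s; split=> // z lt_zs.
by apply/negP => /min_s; rewrite leqNgt lt_zs.
Qed.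

(** The minimization of [partial_recursive] returns only the position of the
    zero; here the search is followed by a total computation from its result. *)
Lemma rec_search n (P : seq nat -> bool) (F : seq nat -> nat) :
  rec n.+1 (fun v => P v : nat) -> rec n.+1 F ->
  partial_recursive (fun (v : n.-tuple nat) y => exists s,
    [/\ P (s :: v), forall z, z < s -> ~~ P (z :: v) & y = F (s :: v)]).
Proof.
move=> rP rF.
pose f : pfun n.+1 := fun v y => y = ~~ P v.
pose h (i : 'I_n.+1) : pfun n :=
  if unlift ord0 i is Some j then proj_pfun j else min_pfun f.
have rh i : partial_recursive (h i).
  rewrite /h; case: unliftP => [j _|_]; first exact: partial_recursive_proj.
  exact: partial_recursive_min (rec_negb rP).
apply: partial_recursive_ext (partial_recursive_comp rF rh) => v y.
have hlift j w : h (lift ord0 j) v w <-> w = tnth v j.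
  by rewrite /h liftK.
have h0 s : h ord0 v s <-> P (s :: v) /\ forall z, z < s -> ~~ P (z :: v).
  rewrite /h unlift_none /min_pfun /f /=; split=> -[Ps Pz]; split.
  - by case: (P _) Ps.
  - by move=> z /Pz[k]; case: (P _).
  - by rewrite Ps.
  - by move=> z /Pz ->; exists 0.
split=> [[w [hw ->]]|[s [Ps Pz ->]]].
  have Ew : tval w = thead w :: v.
    case/tupleP: w hw => s w hw /=; rewrite theadE; congr cons.
    apply/(congr1 val)/eq_from_tnth => j.
    by move/hlift: (hw (lift ord0 j)); rewrite tnthS.
  have /h0[Ps Pz] := hw ord0.
  by exists (thead w); split=> //; rewrite Ew.
exists [tuple of s :: v]; split=> // i.
by case: (unliftP ord0 i) => [j ->|->]; [apply/hlift; rewrite tnthS | apply/h0].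
Qed.

(** * A normal form for partial recursive functions *)

(** [h (t :: v)] is the outcome of [t] steps of a computation of [f] on [v]: 0 if
    it is still running and [y.+1] if it has halted with the value [y]. *)
Definition stepwise n (f : pfun n) (h : seq nat -> nat) :=
  [/\ rec n.+1 h,
      forall (v : n.-tuple nat) t t', t <= t' -> 0 < h (t :: v) ->
        h (t' :: v) = h (t :: v)
    & forall (v : n.-tuple nat) y, f v y <-> exists t, h (t :: v) = y.+1].

Lemma stepwise_total n f : rec n f ->
  stepwise (fun (v : n.-tuple nat) y => y = f v) (fun v => (f (behead v)).+1).
Proof.
move=> rf; split=> //=; first exact/rec_succ/rec_behead.
by move=> v y; split=> [->|[_ [->]]] //; exists 0.
Qed.

(** By monotonicity, finitely many computations that halt have all halted at the
    maximum of their halting times. *)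
Lemma stepwise_bound n m (f : 'I_m -> pfun n) h v (w : 'I_m -> nat) :
  (forall i, stepwise (f i) (h i)) ->
  (forall i, f i v (w i)) -> exists t, forall i, h i (t :: v) = (w i).+1.
Proof.
move=> hf fw; have {}fw i : exists t, h i (t :: v) = (w i).+1.
  by have [_ _ /(_ v (w i))[+ _]] := hf i; apply.
have [t ht] := choice fw; exists (\max_i t i) => i.
by have [_ mono _] := hf i; rewrite (mono _ (t i)) ?ht // leq_bigmax.
Qed.

Lemma stepwise_comp m n (g : pfun m) (f : 'I_m -> pfun n) hg h :
  stepwise g hg -> (forall i, stepwise (f i) (h i)) ->
  exists hc, stepwise (comp_pfun g f) hc.
Proof.
move=> [rg mg Eg] hf.
pose hs := (nth 0 ^~ 0) :: [seq (fun v => (h i v).-1) | i <- enum 'I_m].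
pose running v := \sum_(i <- enum 'I_m) (h i v == 0).
pose hc v := (running v == 0) * hg (evals hs v).
have runningP v : (running v == 0) = [forall i, 0 < h i v].
  rewrite /running big_enum /= sum_nat_eq0; apply: eq_forallb => i.
  by rewrite eqb0 lt0n.
have hs_cons t v (w : m.-tuple nat) : (forall i, h i (t :: v) = (tnth w i).+1) ->
    evals hs (t :: v) = t :: w.
  move=> hw; rewrite /evals /= -map_comp; congr cons.
  rewrite -[RHS](map_tnth_enum w); apply: eq_map => i /=.
  by rewrite hw.
have pos_w t v : (forall i, 0 < h i (t :: v)) ->
    exists w : m.-tuple nat, forall i, h i (t :: v) = (tnth w i).+1.
  move=> hpos; exists [tuple (h i (t :: v)).-1 | i < m] => i.
  by rewrite tnth_mktuple prednK.
have rrunning : rec n.+1 running.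
  apply: rec_fixed_sum => i; have [ri _ _] := hf i.
  exact: rec_eqn ri (rec_const _ 0).
have rhs : rec n.+1 (fun v => hg (evals hs v)).
  apply: rec_comp; first by rewrite /= size_map size_enum_ord.
  case=> [[|i] lt_i] /=; first exact: rec_nth.
  move: lt_i; rewrite /= size_map size_enum_ord ltnS => lt_i.
  rewrite (nth_map (Ordinal lt_i)) ?size_enum_ord //.
  by apply: rec_pred; have [] := hf (nth (Ordinal lt_i) (enum 'I_m) i).
exists hc; split.
- exact: rec_mul (rec_eqn rrunning (rec_const _ 0)) rhs.
- move=> v t t' le_tt'; rewrite /hc !runningP.
  case: forallP => // /pos_w[w hw].
  have hw' i : h i (t' :: v) = (tnth w i).+1.
    by have [_ mono _] := hf i; rewrite (mono _ t) // hw.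
  case: forallP => [_|[]]; last by move=> i; rewrite hw'.
  rewrite !mul1n (hs_cons _ _ w) // (hs_cons _ _ w) //; exact: mg.
- move=> v y; split=> [[w [fw gw]]|[t]].
    have [t1 ht1] := stepwise_bound hf fw.
    have [t2 ht2] := (Eg w y).1 gw.
    exists (maxn t1 t2).
    have hw i : h i (maxn t1 t2 :: v) = (tnth w i).+1.
      by have [_ mono _] := hf i; rewrite (mono _ t1) ?leq_maxl // ht1.
    rewrite /hc runningP (hs_cons _ _ w) //.
    have -> : [forall i, 0 < h i (maxn t1 t2 :: v)].
      by apply/forallP => i; rewrite hw.
    by rewrite mul1n (mg _ t2) ?leq_maxr ?ht2.
  rewrite /hc runningP; case: forallP => // /pos_w[w hw].
  rewrite mul1n (hs_cons _ _ w) // => hgt.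
  exists w; split; last by apply/Eg; exists t.
  by move=> i; have [_ _ E] := hf i; apply/E; exists t.
Qed.

Lemma stepwise_primrec n (g : pfun n) (f : pfun n.+2) hg hf :
  stepwise g hg -> stepwise f hf ->
  exists h, stepwise (primrec_pfun g f) h.
Proof.
move=> [rg mg Eg] [rf mf Ef].
(* A round takes the outcome a of the previous one to its own outcome. *)
pose st t v i a := (0 < a) * hf (t :: i :: a.-1 :: v).
pose it k t v := iteri k (st t v) (hg (t :: v)).
pose h v := it (nth 0 v 1) (nth 0 v 0) (behead (behead v)).
have mono k (v : n.-tuple nat) t t' : t <= t' -> 0 < it k t v ->
    it k t' v = it k t v.
  move=> le_tt'; elim: k => [|k IHk] /=; first exact: mg.
  rewrite -/(it k t v) -/(it k t' v) /st muln_gt0 => /andP[pos_k pos_f].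
  rewrite IHk; first last.
    by case: (it k t v) pos_k.
  case: (it k t v) pos_f => //= a; rewrite !mul1n.
  by have := mf [tuple of k :: a :: v] _ _ le_tt'; apply.
have trace k (v : n.-tuple nat) y :
    (exists s : nat -> nat, [/\ g v (s 0),
      forall i, i < k -> f [tuple of i :: s i :: v] (s i.+1) & y = s k]) <->
    exists t, it k t v = y.+1.
  elim: k y => [|k IHk] y.
    split=> [[s [gs _ ->]]|[t ht]]; first exact/Eg.
    by exists (fun=> y); split=> //; apply/Eg; exists t.
  split=> [[s [gs fs ->]]|[t /=]].
    have [|t1 ht1] := (IHk (s k)).1.
      by exists s; split=> // i lt_ik; apply: fs; exact: leqW.
    have [t2 ht2] := (Ef _ _).1 (fs k (ltnSn k)).
    exists (maxn t1 t2); rewrite /= -/(it k _ v) /st.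
    rewrite (mono k v t1) ?ht1 ?leq_maxl // mul1n.
    by rewrite (mf [tuple of k :: s k :: v] t2) ?leq_maxr ?ht2.
  rewrite -/(it k t v) /st; case E: (it k t v) => [|a] //=; rewrite mul1n => hfa.
  have [s [gs fs Ea]] : exists s : nat -> nat, [/\ g v (s 0),
      forall i, i < k -> f [tuple of i :: s i :: v] (s i.+1) & a = s k].
    by apply/IHk; exists t.
  exists (fun i => if i <= k then s i else y); split=> [//|i|]; last by rewrite ltnn.
  rewrite ltnS => le_ik; rewrite le_ik; case: (ltngtP i k) le_ik => // [lt_ik|Eik] _.
    exact: fs.
  by rewrite Eik -Ea; apply/Ef; exists t.
exists h; split.
- rewrite /h /it.
  apply: (@rec_iteri n.+2 (fun v => nth 0 v 1)
    (fun v => hg (nth 0 v 0 :: behead (behead v)))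
    (fun i a v => st (nth 0 v 0) (behead (behead v)) i a)).
  + exact: rec_nth.
  + exact: (@rec_subst_behead n 2 hg [:: 0] rg).
  + apply: rec_mul.
      by apply: rec_leq; [exact: rec_const | exact: rec_nth].
    pose hs := (nth 0 ^~ 2) :: (nth 0 ^~ 0) :: (fun v => (nth 0 v 1).-1) ::
      [seq nth 0 ^~ i | i <- iota 4 n].
    have := @rec_comp n.+4 hf hs; rewrite /= size_map size_iota => /(_ rf) rc.
    apply: rec_ext (rc _) => [v|[[|[|[|i]]] lt_i]] /=.
    * congr (hf [:: _, _, _ & _]); first by rewrite !nth_behead.
      by rewrite /evals -map_comp (@map_nth_behead 4 n).
    * exact: rec_nth.
    * exact: rec_nth.
    * exact/rec_pred/rec_nth.
    * by rewrite (nth_map 0) ?size_iota // nth_iota //; exact: rec_nth.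
- move=> v t t'; case/tupleP: v => k v; exact: mono.
- move=> v y; case/tupleP: v => k v.
  rewrite /primrec_pfun theadE.
  have -> : [tuple of behead [tuple of k :: v]] = v by apply: val_inj.
  have E i a : f [tuple of i :: a :: behead [tuple of k :: v]] =
               f [tuple of i :: a :: v] by congr f; apply: val_inj.
  split=> [[s [gs fs Ey]]|/trace[s [gs fs Ey]]]; first apply/trace.
    by exists s; split=> // i /fs; rewrite E.
  by exists s; split=> // i /fs; rewrite E.
Qed.

Lemma stepwise_min n (f : pfun n.+1) hf :
  stepwise f hf -> exists h, stepwise (min_pfun f) h.
Proof.
move=> [rf mf Ef].
(* y is the value found when the computation at y has halted with 0 and those
   at all z < y with a nonzero value. *)
pose found t v y := (hf (t :: y :: v) == 1) &&
  (\sum_(0 <= z < y) (hf (t :: z :: v) <= 1) == 0).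
pose h v := \sum_(0 <= y < nth 0 v 0)
  found (nth 0 v 0) (behead v) y * y.+1.
have foundP t v y : found t v y <->
    hf (t :: y :: v) = 1 /\ forall z, z < y -> 1 < hf (t :: z :: v).
  rewrite /found; split=> [/andP[/eqP-> /eqP E]|[-> E]].
    split=> // z lt_zy; move: E; rewrite big_mkord => /eqP.
    rewrite sum_nat_eq0 => /forallP/(_ (Ordinal lt_zy)) /=.
    by case: leqP.
  rewrite eqxx big_mkord sum_nat_eq0; apply/forallP=> -[z lt_zy] /=.
  by case: leqP (E z lt_zy).
have found_uniq t v y y' : found t v y -> found t v y' -> y = y'.
  move=> /foundP[Ey ltY] /foundP[Ey' ltY'].
  by case: (ltngtP y y') => // [/ltY'|/ltY]; rewrite ?Ey ?Ey'.
have hP t (v : n.-tuple nat) y :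
    h (t :: v) = y.+1 <-> y < t /\ found t v y.
  rewrite /h /=; split=> [|[lt_yt fy]].
    have [[y' [lt_y' fy']]|nf] := pselect (exists y', y' < t /\ found t v y').
      rewrite (bigD1_seq y') ?mem_index_iota ?iota_uniq //= fy' mul1n big1 ?addn0.
        by case=> <-.
      move=> i ne_i; case Ei: (found t v i) => //.
      by rewrite (found_uniq _ _ _ _ Ei fy') eqxx in ne_i.
    rewrite big_nat_cond big1 // => i /andP[/andP[_ lt_i] _].
    by case Ei: (found t v i) => //; case: nf; exists i.
  rewrite (bigD1_seq y) ?mem_index_iota ?iota_uniq //= fy mul1n big1 ?addn0 //.
  move=> i ne_i; case Ei: (found t v i) => //.
  by rewrite (found_uniq _ _ _ _ Ei fy) eqxx in ne_i.
have found_mono (v : n.-tuple nat) t t' y : t <= t' -> found t v y -> found t' v y.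
  move=> le_tt' /foundP[Ey Ez]; apply/foundP; split=> [|z lt_zy].
    by rewrite (mf [tuple of y :: v] t) //= Ey.
  by rewrite (mf [tuple of z :: v] t) //= ?Ez // ltnW // Ez.
exists h; split.
- apply: (@rec_sum _ _ (fun y v => found (nth 0 v 0) (behead v) y * y.+1)).
    exact: rec_nth.
  have rhf : rec n.+2 (fun v =>
      hf (nth 0 (behead v) 0 :: nth 0 v 0 :: behead (behead v))).
    have := @rec_subst_behead n 2 hf [:: 1; 0] rf isT.
    by apply: rec_ext => v; rewrite nth_behead.
  apply: rec_mul; last exact/rec_succ/rec_nth.
  apply: rec_andb; first exact: rec_eqn rhf (rec_const _ 1).
  apply: rec_eqn; last exact: rec_const.
  apply: (@rec_sum _ _ (fun z v => 
    hf (nth 0 (behead v) 0 :: z :: behead (behead v)) <= 1)).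
    exact: rec_nth.
  apply: rec_leq; last exact: rec_const.
  have := @rec_subst_behead n 3 hf [:: 2; 0] rf isT.
  by apply: rec_ext => v; rewrite !nth_behead.
- move=> v t t' le_tt'; case E: (h (t :: v)) => [|y] // _.
  move/hP: E => [lt_yt fy]; apply/hP; split; first exact: leq_trans le_tt'.
  exact: found_mono fy.
- move=> v y; split=> [[fy fz]|[t /hP[lt_yt /foundP[Ey Ez]]]]; last first.
    split=> [|z lt_zy]; first by apply/Ef; exists t.
    exists (hf (t :: z :: v)).-2; apply/Ef; exists t => /=.
    have := Ez z lt_zy; case: (hf _) => [|[]] //.
  have fz' z : exists k, z < y -> f [tuple of z :: v] k.+1.
    case: (ltnP z y) => [/fz[k fk]|_]; first by exists k.
    by exists 0.
  have [k fk] := choice fz'.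
  have tz z : exists t, z < y -> hf (t :: z :: v) = (k z).+2.
    case: (ltnP z y) => [lt_zy|_]; last by exists 0.
    by have [t ht] := (Ef _ _).1 (fk z lt_zy); exists t.
  have [t ht] := choice tz.
  have [t0 ht0] := (Ef _ _).1 fy.
  pose s := maxn y.+1 (maxn t0 (\max_(z < y) t z)).
  exists s; apply/hP; split; first by rewrite /s leq_max leqnn.
  apply/foundP; split=> [|z lt_zy].
    by rewrite (mf [tuple of y :: v] t0) /= ?ht0 // /s !leq_max leqnn orbT.
  rewrite (mf [tuple of z :: v] (t z)) /= ?ht // /s !leq_max.
  by rewrite (leq_bigmax (Ordinal lt_zy)) !orbT.
Qed.

(** Kleene's normal form: allowing t steps to every part of a computation turns
    partial recursion into total recursion. *)
Theorem normal_form n (f : pfun n) :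
  partial_recursive f -> exists h, stepwise f h.
Proof.
elim=> {n f} [n||n i|m n g f _ [hg Hg] _ Hf|n g f _ [hg Hg] _ [hf Hf]|n f _ [hf Hf]].
- by eexists; exact: (stepwise_total (rec_const n 0)).
- eexists; have := stepwise_total (rec_succ (rec_nth (isT : 0 < 1))).
  congr (stepwise _ _); apply/funext => v; apply/funext => y.
  by case/tupleP: v => x v.
- eexists; have := stepwise_total (rec_nth (ltn_ord i)).
  congr (stepwise _ _); apply/funext => v; apply/funext => y.
  by rewrite /proj_pfun (tnth_nth 0).
- by have [h hh] := choice Hf; exact: stepwise_comp Hg hh.
- exact: stepwise_primrec Hg Hf.
- exact: stepwise_min Hf.
Qed.

(** * Counter programs *)

(** Programs over registers holding natural numbers. [Loop r c] decrements [r]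
    before each run of [c] and stops when [r] is 0; [Ask r] increments [r] if the
    number in the query register belongs to the oracle. *)
Inductive cmd :=
| Skip
| Inc of nat
| Seq of cmd & cmd
| Loop of nat & cmd
| Ask of nat.

Definition query_reg := 1.

Definition upd (s : nat -> nat) (r x : nat) : nat -> nat :=
  fun k : nat => if k == r then x else s k.

(** Termination in a given final state; [b] bounds all numbers queried. *)
Inductive exec (B : set nat) (b : nat) :
    cmd -> (nat -> nat) -> (nat -> nat) -> Prop :=
| exec_skip s : exec B b Skip s s
| exec_inc r s : exec B b (Inc r) s (upd s r (s r).+1)
| exec_seq c1 c2 s1 s2 s3 :
    exec B b c1 s1 s2 -> exec B b c2 s2 s3 -> exec B b (Seq c1 c2) s1 s3
| exec_loop0 r c s : s r = 0 -> exec B b (Loop r c) s s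
| exec_loopS r c s1 s2 s3 k :
    s1 r = k.+1 -> exec B b c (upd s1 r k) s2 ->
    exec B b (Loop r c) s2 s3 -> exec B b (Loop r c) s1 s3
| exec_ask r s : s query_reg <= b ->
    exec B b (Ask r) s
      (if s query_reg \in B then upd s r (s r).+1 else s).

Ltac upd_eq := rewrite /upd;
  repeat (case: eqP => ?); subst; try lia; try congruence.

Ltac state_eq := apply/funext => ?; upd_eq.

Lemma exec_eq B b c s s1 s2 : exec B b c s s1 -> s1 = s2 -> exec B b c s s2.
Proof. by move=> + <-. Qed.

Lemma exec_clear B b r s : exec B b (Loop r Skip) s (upd s r 0).
Proof.
have [k] := ubnP (s r); elim: k s => // k IHk s; rewrite ltnS => le_k.
case E: (s r) => [|x].
  by apply: exec_eq (exec_loop0 _ _ _ E) _; state_eq.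
apply: exec_eq (exec_loopS E (exec_skip _ _ _) (IHk _ _)) _.
  by rewrite /upd eqxx; lia.
state_eq.
Qed.

Lemma exec_move B b r r' s : r != r' ->
  exec B b (Loop r (Inc r')) s (upd (upd s r 0) r' (s r' + s r)).
Proof.
move=> /eqP ne; have [k] := ubnP (s r).
elim: k s => // k IHk s; rewrite ltnS => le_k.
case E: (s r) => [|x].
  by apply: exec_eq (exec_loop0 _ _ _ E) _; state_eq.
apply: exec_eq (exec_loopS E (exec_inc _ _ _ _) (IHk _ _)) _.
  by rewrite /upd eqxx; case: eqP => //; lia.
state_eq.
Qed.

Lemma exec_move2 B b r x y s : r != x -> r != y -> x != y ->
  exec B b (Loop r (Seq (Inc x) (Inc y))) s
    (upd (upd (upd s r 0) x (s x + s r)) y (s y + s r)).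
Proof.
move=> /eqP nx /eqP ny /eqP nxy; have [k] := ubnP (s r).
elim: k s => // k IHk s; rewrite ltnS => le_k.
case E: (s r) => [|z].
  by apply: exec_eq (exec_loop0 _ _ _ E) _; state_eq.
apply: exec_eq (exec_loopS E
  (exec_seq (exec_inc _ _ _ _) (exec_inc _ _ _ _)) (IHk _ _)) _.
  by rewrite /upd eqxx; do !case: eqP => //; lia.
state_eq.
Qed.

Definition copy r out tmp :=
  Seq (Loop r (Seq (Inc tmp) (Inc out))) (Loop tmp (Inc r)).

Lemma exec_copy B b r out tmp s :
  r != out -> r != tmp -> out != tmp -> s tmp = 0 ->
  exec B b (copy r out tmp) s (upd s out (s out + s r)).
Proof.
move=> no nt not s0.
apply: exec_seq; first by apply: exec_move2 => //; rewrite eq_sym.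
apply: exec_eq; first by apply: exec_move; rewrite eq_sym.
move/eqP: no; move/eqP: nt; move/eqP: not => *; state_eq.
Qed.

Fixpoint repeat_cmd (c : nat -> cmd) m :=
  if m is k.+1 then Seq (repeat_cmd c k) (c k) else Skip.

Lemma exec_repeat B b c m (s : nat -> nat -> nat) :
  (forall i, i < m -> exec B b (c i) (s i) (s i.+1)) ->
  exec B b (repeat_cmd c m) (s 0) (s m).
Proof.
elim: m => [|m IHm] es /=; first exact: exec_skip.
apply: exec_seq (es m (ltnSn m)); apply: IHm => i lt_im.
by apply: es; exact: leqW.
Qed.

(** Adding the result to [out] and restoring all other registers makes programs
    composable: all of them may use the registers from [b] on as scratch space,
    which contains 0 before and after. *)
Definition implements n (f : pfun n) (c : cmd) (ins : n.-tuple nat) out b :=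
  forall B bound s y, f (map_tuple s ins) y -> (forall r, b <= r -> s r = 0) ->
    exec B bound c s (upd s out (s out + y)).

Definition implementable n (f : pfun n) := forall (ins : n.-tuple nat) out b,
  (forall i, tnth ins i < b) -> out < b -> (forall i, tnth ins i != out) ->
  exists c, implements f c ins out b.

Lemma implementable_succ : implementable succ_pfun.
Proof.
move=> ins out b lti lto nio; exists (Seq (copy (thead ins) out b) (Inc out)).
move=> B bound s y; case/tupleP: ins lti nio => r ins lti nio.
rewrite /succ_pfun => -> s0.
have := lti ord0; have := nio ord0; rewrite !tnth0 !theadE => nr lr.
apply: exec_seq.
  by apply: exec_copy; rewrite ?s0 //; apply: contraTN isT => /eqP; lia.
apply: exec_eq (exec_inc _ _ _ _) _.
rewrite /thead (_ : tnth (map_tuple s _) ord0 = s r) //.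
state_eq.
Qed.

Lemma implementable_proj n (i : 'I_n) : implementable (proj_pfun i).
Proof.
move=> ins out b lti lto nio; exists (copy (tnth ins i) out b).
move=> B bound s y; rewrite /proj_pfun tnth_map => -> s0.
apply: exec_copy; rewrite ?s0 //; first by have := lti i; lia.
by lia.
Qed.

Lemma implementable_comp m n (g : pfun m) (h : 'I_m -> pfun n) :
  implementable g -> (forall i, implementable (h i)) ->
  implementable (comp_pfun g h).
Proof.
move=> cg ch ins out b lti lto nio.
(* Registers b, ..., b + m - 1 receive the values of the h i. *)
have [cgs Hg] := cg [tuple b + i | i < m] out (b + m)
  ltac:(by move=> i; rewrite tnth_mktuple ltn_add2l) ltac:(by lia)
  ltac:(by move=> i; rewrite tnth_mktuple; lia).
have Hc (i : 'I_m) : exists c, implements (h i) c ins (b + i) (b + m).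
  apply: ch => [j||j]; have := lti; first by move/(_ j); lia.
    by rewrite ltn_add2l.
  by move/(_ j); lia.
have Hc' (i : nat) : exists c, forall lt_im : i < m,
    implements (h (Ordinal lt_im)) c ins (b + i) (b + m).
  have [lt_im|nlt] := pselect (i < m); last by exists Skip.
  have [c hc] := Hc (Ordinal lt_im); exists c => lt'.
  by rewrite (bool_irrelevance lt' lt_im).
have [c hc] := choice Hc'.
exists (Seq (repeat_cmd c m)
         (Seq cgs (repeat_cmd (fun i => Loop (b + i) Skip) m))).
move=> B bound s y [w [hw gw]] s0.
pose s1 j r := if (b <= r < b + j) then nth 0 w (r - b) else s r.
have Es0 : s = s1 0.
  by apply/funext => r; rewrite /s1; case: ifP => //; lia.
rewrite {1}Es0; apply: (@exec_seq _ _ _ _ _ (s1 m)).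
  apply: exec_repeat => i lt_im.
  apply: exec_eq (hc i lt_im B bound _ (nth 0 w i) _ _) _.
  - have -> : map_tuple (s1 i) ins = map_tuple s ins.
      apply/eq_from_tnth => j; rewrite !tnth_map /s1.
      by case: ifP (lti j) => //; lia.
    by have := hw (Ordinal lt_im); rewrite (tnth_nth 0).
  - move=> r le_r; rewrite /s1; case: ifP; first by lia.
    by move=> _; apply: s0; lia.
  - apply/funext => r; rewrite /upd /s1 s0; last by lia.
    case: eqP => [->|ne_r].
      have -> : b <= b + i < b + i.+1 by lia.
      by rewrite addKn; case: ifP => //; lia.
    by case: ifP => h1; case: ifP => h2 //; lia.
apply: exec_seq.
  apply: Hg.
  - suff -> : map_tuple (s1 m) [tuple b + i | i < m] = w by exact: gw.
    apply/eq_from_tnth => j; rewrite tnth_map tnth_mktuple /s1.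
    by rewrite leq_addr ltn_add2l ltn_ord addKn (tnth_nth 0).
  - move=> r le_r; rewrite /s1; case: ifP; first by lia.
    by move=> _; apply: s0; lia.
pose s2 j r := if (b <= r < b + j) then 0 else upd (s1 m) out (s1 m out + y) r.
have -> : upd (s1 m) out (s1 m out + y) = s2 0.
  by apply/funext => r; rewrite /s2; case: ifP => //; lia.
apply: (@exec_eq _ _ _ _ (s2 m)).
  apply: exec_repeat => i lt_im; apply: exec_eq (exec_clear _ _ _ _) _.
  apply/funext => r; rewrite {1}/upd /s2; case: eqP => [->|ne].
    by case: ifP => //; lia.
  by case: ifP => h1; case: ifP => h2 //; lia.
apply/funext => r; rewrite /s2 /upd /s1; case: ifP => h1.
  case: eqP; first by lia.
  by move=> _; rewrite s0 //; lia.
by case: eqP => _; [case: ifP => //; lia | rewrite h1].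
Qed.

Lemma implementable_primrec n (g : pfun n) (h : pfun n.+2) :
  implementable g -> implementable h -> implementable (primrec_pfun g h).
Proof.
move=> cg ch ins; case/tupleP: ins => k ins out b lti lto nio.
have ltk : k < b by have := lti ord0; rewrite tnth0.
have nko : k != out by have := nio ord0; rewrite tnth0.
have {}lti i : tnth ins i < b by have := lti (lift ord0 i); rewrite tnthS.
have {}nio i : tnth ins i != out by have := nio (lift ord0 i); rewrite tnthS.
(* Register b counts the remaining rounds, b + 1 holds the current value, b + 2
   the current index, and b + 3 receives the next value. *)
have [cg1 Hg] := cg ins b.+1 b.+4 ltac:(by move=> i; have := lti i; lia)
  ltac:(by lia) ltac:(by move=> i; have := lti i; lia).
have [ch1 Hh] := ch [tuple of b.+2 :: b.+1 :: ins] b.+3 b.+4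
  ltac:(by case=> [[|[|i]] lt_i]; rewrite (tnth_nth 0) /=; try lia;
        have := lti (Ordinal (lt_i : i < n)); rewrite (tnth_nth 0) /=; lia)
  ltac:(by lia)
  ltac:(by case=> [[|[|i]] lt_i]; rewrite (tnth_nth 0) /=; try lia;
        have := lti (Ordinal (lt_i : i < n)); rewrite (tnth_nth 0) /=; lia).
pose body := Seq ch1 (Seq (Loop b.+1 Skip)
                     (Seq (Loop b.+3 (Inc b.+1)) (Inc b.+2))).
exists (Seq (copy k b b.+4) (Seq cg1 (Seq (Loop b body)
         (Seq (Loop b.+1 (Inc out)) (Loop b.+2 Skip))))).
move=> B bound s y; rewrite /primrec_pfun.
set v := map_tuple s [tuple of k :: ins].
have -> : thead v = s k by rewrite /thead (tnth_nth 0).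
have -> : [tuple of behead v] = map_tuple s ins by apply: val_inj.
have Ev i a : [tuple of i :: a :: behead v] =
    [tuple of i :: a :: map_tuple s ins] by apply: val_inj.
move=> [t [gt ht ->]] s0.
pose sj j := upd (upd (upd s b (s k - j)) b.+1 (t j)) b.+2 j.
have Esj j : map_tuple (sj j) ins = map_tuple s ins.
  apply/eq_from_tnth => i; rewrite !tnth_map /sj /upd.
  by have := lti i; do 3?(case: eqP => [->|_]; first by lia).
apply: exec_seq.
  by apply: exec_copy; rewrite ?s0 //; lia.
apply: (@exec_seq _ _ _ _ _ (sj 0)).
  apply: exec_eq (Hg B bound _ (t 0) _ _) _.
  - set s' := upd _ _ _; suff -> : map_tuple s' ins = map_tuple s ins by [].
    apply/eq_from_tnth => i; rewrite !tnth_map /s' /upd.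
    by have := lti i; case: eqP => [->|_] //; lia.
  - by move=> r le_r; rewrite /upd; case: eqP => [|_]; [lia | apply: s0; lia].
  - rewrite /sj; apply/funext => r; rewrite /upd.
    have := s0 b; have := s0 b.+1; have := s0 b.+2.
    by do !case: eqP => ?; subst; try lia.
apply: (@exec_seq _ _ _ _ _ (sj (s k))).
  have loop j : j <= s k ->
      exec B bound (Loop b body) (sj j) (sj (s k)).
    move=> le_j; rewrite -(subKn le_j).
    have := leq_subr j (s k); move: (s k - j) => d.
    elim: d => [|d IHd] le_d.
      by rewrite subn0; apply: exec_loop0; rewrite /sj /upd; do !case: eqP; lia.
    have {IHd} IH := IHd (ltnW le_d).
    apply: (exec_loopS (k := d)) IH; first by rewrite /sj /upd eqxx; do !case: eqP; lia.
    set j' := s k - d.+1; have Ej' : s k - d = j'.+1 by rewrite /j'; lia.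
    have lt_j' : j' < s k by rewrite /j'; lia.
    apply: exec_seq.
      apply: (Hh B bound _ (t j'.+1)).
        set w := map_tuple _ _.
        have -> : w = [tuple of j' :: t j' :: map_tuple s ins].
          apply: val_inj; rewrite /= -[map s ins]/(val (map_tuple s ins)).
          rewrite -(Esj j') /=.
          congr [:: _, _ & _]; try by rewrite /sj /upd; do !case: eqP; lia.
          apply/eq_in_map => r /tnthP[i ->].
          by rewrite /upd; have := lti i; case: eqP => [->|_] //; lia.
        by rewrite -Ev; exact: ht.
      move=> r le_r; rewrite /sj /upd; do !(case: eqP => [|_]; first by lia).
      by apply: s0; lia.
    apply: exec_seq (exec_clear _ _ _ _) _.
    apply: exec_seq; first by apply: exec_move; lia.
    apply: exec_eq (exec_inc _ _ _ _) _.
    rewrite Ej' /sj; apply/funext => r; rewrite /upd.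
    have := s0 b.+3.
    by do !case: eqP => ?; subst; try lia.
  exact: loop.
apply: exec_seq; first by apply: exec_move; lia.
apply: exec_eq (exec_clear _ _ _ _) _.
rewrite /sj; apply/funext => r; rewrite /upd.
have := s0 b; have := s0 b.+1; have := s0 b.+2.
by do !case: eqP => ?; subst; try lia.
Qed.

Lemma implementable_min n (f : pfun n.+1) :
  implementable f -> implementable (min_pfun f).
Proof.
move=> cf ins out b lti lto nio.
(* Register b holds the candidate, b + 1 receives the value there, and b + 2 is
   1 as long as the search has to go on. *)
have [c Hc] := cf [tuple of b :: ins] b.+1 b.+3
  ltac:(by case=> [[|i] lt_i]; rewrite (tnth_nth 0) /=; try lia;
        have := lti (Ordinal (lt_i : i < n)); rewrite (tnth_nth 0) /=; lia)
  ltac:(by lia)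
  ltac:(by case=> [[|i] lt_i]; rewrite (tnth_nth 0) /=; try lia;
        have := lti (Ordinal (lt_i : i < n)); rewrite (tnth_nth 0) /=; lia).
pose next := Loop b.+1 (Seq (Loop b.+1 Skip) (Seq (Inc b) (Inc b.+2))).
exists (Seq (Inc b.+2) (Seq (Loop b.+2 (Seq c next)) (Loop b (Inc out)))).
move=> B bound s y [fy fz] s0.
pose sj j := upd (upd s b j) b.+2 1.
have Hcj j x : f [tuple of j :: map_tuple s ins] x ->
    exec B bound c (upd (upd s b j) b.+2 0)
      (upd (upd (upd s b j) b.+2 0) b.+1 x).
  move=> fx; apply: exec_eq (Hc B bound _ x _ _) _.
  - set w := map_tuple _ _.
    have -> : w = [tuple of j :: map_tuple s ins].
      apply: val_inj => /=; congr (_ :: _); first by upd_eq.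
      apply/eq_in_map => r /tnthP[i ->].
      by have := lti i; move: (tnth ins i : nat) => r0 lt_r; upd_eq.
    exact: fx.
  - move=> r le_r; rewrite /upd; do !(case: eqP => [|_]; first by lia).
    by apply: s0; lia.
  - have := s0 b.+1 ltac:(by lia) => E; congr upd.
    by upd_eq.
have loop j : j <= y ->
    exec B bound (Loop b.+2 (Seq c next)) (sj j) (upd s b y).
  move=> le_jy; rewrite -(subKn le_jy).
  have := leq_subr j y; move: (y - j) => d.
  have Eb := s0 b.+1 ltac:(by lia); have Eb2 := s0 b.+2 ltac:(by lia).
  have start i : upd (sj i) b.+2 0 = upd (upd s b i) b.+2 0 by rewrite /sj; state_eq.
  elim: d => [|d IHd] le_d.
    rewrite subn0; apply: (exec_loopS (k := 0)); first by rewrite /sj /upd eqxx.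
      rewrite start; apply: exec_seq (Hcj y 0 fy) _.
      by apply: exec_loop0; rewrite /upd eqxx.
    apply: exec_eq (exec_loop0 _ _ _ _) _; first by upd_eq.
    by state_eq.
  have IH := IHd (ltnW le_d).
  apply: (exec_loopS (k := 0)) IH; first by rewrite /sj /upd eqxx.
  set j' := y - d.+1; have Ej' : y - d = j'.+1 by rewrite /j'; lia.
  have [k fk] : exists k, f [tuple of j' :: map_tuple s ins] k.+1.
    by apply: fz; rewrite /j'; lia.
  rewrite start; apply: exec_seq (Hcj j' _ fk) _.
  apply: (exec_loopS (k := k)); first by rewrite /upd eqxx.
    apply: exec_seq (exec_clear _ _ _ _) _.
    exact: exec_seq (exec_inc _ _ _ _) (exec_inc _ _ _ _).
  apply: exec_eq (exec_loop0 _ _ _ _) _; first by upd_eq.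
  by rewrite /sj Ej'; state_eq.
have Eb := s0 b ltac:(by lia); have Eb2 := s0 b.+2 ltac:(by lia).
apply: exec_seq (exec_inc _ _ _ _) _.
apply: (@exec_seq _ _ _ _ _ (upd s b y)).
  have -> : upd s b.+2 (s b.+2).+1 = sj 0 by rewrite /sj; state_eq.
  exact: loop.
apply: exec_eq (exec_move _ _ _ _) _; first by lia.
by state_eq.
Qed.

Theorem partial_recursive_implementable n (f : pfun n) :
  partial_recursive f -> implementable f.
Proof.
elim=> {n f} [n||n i|m n g f _ + _|n g f _ + _|n f _].
- move=> ins out b _ _ _; exists Skip => B bound s y; rewrite /zero_pfun => -> _.
  by apply: exec_eq (exec_skip _ _ _) _; state_eq.
- exact: implementable_succ.
- exact: implementable_proj.
- exact: implementable_comp.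
- exact: implementable_primrec.
- exact: implementable_min.
Qed.

(** * The initial segment of the oracle as a number *)

(** The bit at 0 is the highest one, so that the segments of the base-two
    expansion of x, for 0 <= x < 1, are the integer parts of 2 ^ k * x. *)
Fixpoint segment (B : set nat) k : nat :=
  if k is j.+1 then (segment B j).*2 + (j \in B) else 0.

Definition read_segment k acc tmp :=
  Loop k (Seq (Ask tmp) (Seq (Loop acc (Seq (Inc tmp) (Inc tmp)))
         (Seq (Loop tmp (Inc acc)) (Inc query_reg)))).

Lemma exec_double B b r r' s : r != r' ->
  exec B b (Loop r (Seq (Inc r') (Inc r'))) s
    (upd (upd s r 0) r' (s r' + (s r).*2)).
Proof.
move=> /eqP ne; have [k] := ubnP (s r).
elim: k s => // k IHk s; rewrite ltnS => le_k.
case E: (s r) => [|x].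
  by apply: exec_eq (exec_loop0 _ _ _ E) _; state_eq.
apply: exec_eq (exec_loopS E
  (exec_seq (exec_inc _ _ _ _) (exec_inc _ _ _ _)) (IHk _ _)) _.
  by rewrite /upd eqxx; do !case: eqP => //; lia.
state_eq.
Qed.

Lemma exec_read_segment B b k acc tmp s :
  uniq [:: query_reg; k; acc; tmp] ->
  s query_reg = 0 -> s acc = 0 -> s tmp = 0 -> s k <= b.+1 ->
  exec B b (read_segment k acc tmp) s
    (upd (upd (upd s k 0) query_reg (s k)) acc (segment B (s k))).
Proof.
rewrite /= !inE !negb_or -!andbA => /and5P[/eqP? /eqP? /eqP? /eqP? /andP[/eqP? /andP[/eqP? _]]].
move=> sq sa st le_k.
pose sj j := upd (upd (upd s k (s k - j)) query_reg j) acc (segment B j).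
have -> : upd (upd (upd s k 0) query_reg (s k)) acc (segment B (s k)) = sj (s k).
  by rewrite /sj subnn.
have {1}-> : s = sj 0 by rewrite /sj; state_eq.
suff loop d : d <= s k ->
    exec B b (read_segment k acc tmp) (sj (s k - d)) (sj (s k)).
  by have := loop (s k) (leqnn _); rewrite subnn.
elim: d => [|d IHd] le_d.
  by rewrite subn0; apply: exec_loop0; rewrite /sj; upd_eq.
have IH := IHd (ltnW le_d).
apply: (exec_loopS (k := d)) IH.
  by rewrite /sj /upd eqxx; do !case: eqP => //; lia.
set j := s k - d.+1; have Ej : s k - d = j.+1 by rewrite /j; lia.
apply: (@exec_seq _ _ _ _ _ (upd (upd (sj j) k d) tmp (j \in B))).
  have Eq : upd (sj j) k d query_reg = j by rewrite /sj; upd_eq.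
  apply: exec_eq (exec_ask _ _ _) _; first by rewrite Eq /j; lia.
  by rewrite Eq; case: (j \in B); rewrite /sj; state_eq.
apply: exec_seq; first by apply: exec_double; apply/eqP; lia.
apply: exec_seq; first by apply: exec_move; apply/eqP; lia.
apply: exec_eq (exec_inc _ _ _ _) _.
by rewrite /sj Ej; apply/funext => r; rewrite /upd /=; do !case: eqP => ?; subst; try lia.
Qed.

(** * Counter programs on oracle machines *)

(** Instructions of a machine that keeps register [r] in unary on tape [r]:
    [Pop r j] erases a one, or jumps to [j] if there is none; [Ask_else j]
    queries the oracle and jumps to [j] if the answer is no. *)
Inductive instr :=
| MoveL of nat
| Put of nat
| Pop of nat & nat
| Jump of nat
| AskElse of nat
| Stop of bool.

Fixpoint code_size c :=
  match c with
  | Skip => 0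
  | Inc _ => 2
  | Seq c1 c2 => code_size c1 + code_size c2
  | Loop _ c => (code_size c).+2
  | Ask _ => 3
  end.

(** The code of [c] when its first instruction is at address [o]. *)
Fixpoint code c o : seq instr :=
  match c with
  | Skip => [::]
  | Inc r => [:: MoveL r; Put r]
  | Seq c1 c2 => code c1 o ++ code c2 (o + code_size c1)
  | Loop r c => Pop r (o + code_size c).+2 :: rcons (code c o.+1) (Jump o)
  | Ask r => [:: AskElse o.+3; MoveL r; Put r]
  end.

Lemma size_code c o : size (code c o) = code_size c.
Proof.
elim: c o => //= [c1 IH1 c2 IH2|r c IHc] o; first by rewrite size_cat IH1 IH2.
by rewrite size_rcons IHc.
Qed.

Fixpoint registers_below K c :=
  match c with
  | Skip => true
  | Inc r => r < K
  | Seq c1 c2 => registers_below K c1 && registers_below K c2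
  | Loop r c => (r < K) && registers_below K c
  | Ask r => r < K
  end.

Lemma registers_belowW K K' c :
  K <= K' -> registers_below K c -> registers_below K' c.
Proof.
move=> le_K; elim: c => //= [r|c1 IH1 c2 IH2 /andP[/IH1-> /IH2]|r c IHc /andP[]|r] //.
- by move/leq_trans; apply.
- by move=> lt_r /IHc ->; rewrite (leq_trans lt_r).
- by move/leq_trans; apply.
Qed.

Lemma registers_bounded c : exists K, registers_below K c.
Proof.
elim: c => [|r|c1 [K1 H1] c2 [K2 H2]|r c [K HK]|r] /=.
- by exists 0.
- by exists r.+1.
- exists (maxn K1 K2); rewrite (registers_belowW (leq_maxl _ _) H1).
  by rewrite (registers_belowW (leq_maxr _ _) H2).
- exists (maxn r.+1 K); rewrite leq_maxl.
  by rewrite (registers_belowW (leq_maxr _ _) HK).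
- by exists r.+1.
Qed.

(** On every tape that an instruction does not act upon, the machine rewrites
    the symbol read and stays. *)
Definition action_of k N (I : instr) (pc : nat) : action 'I_N.+1 bool k :=
  match I with
  | MoveL r => Work (fun a => (inord pc.+1,
      [tuple (tnth a i, if i == r :> nat then MoveLeft else Stay) | i < k]))
  | Put r => Work (fun a => (inord pc.+1,
      [tuple (if i == r :> nat then true else tnth a i, Stay) | i < k]))
  | Pop r j => Work (fun a =>
      if nth false a r
      then (inord pc.+1,
        [tuple (tnth a i, if i == r :> nat then MoveRight else Stay) | i < k])
      else (inord j, [tuple (tnth a i, Stay) | i < k]))
  | Jump j => Work (fun a => (inord j, [tuple (tnth a i, Stay) | i < k]))
  | AskElse j => Query (inord pc.+1) (inord j)
  | Stop b => Halt b
  end.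

Lemma query_tape_subproof k : query_reg < k.+2.
Proof. by []. Qed.

Definition machine k (P : seq instr) : oracle_machine :=
  @OracleMachine k.+2 ord0 (Ordinal (query_tape_subproof k))
    'I_(size P).+1 bool false true isT ord0
    (fun q => action_of k.+2 (size P) (nth (Stop false) P q) q).

Notation number := (tape_number true).

Lemma number_rewrite (t : tape bool) :
  number (tape_write (tape_read false t) t) = number t.
Proof. by case: t => l [|a r]. Qed.

Lemma number_read (t : tape bool) : tape_read false t = (0 < number t).
Proof. by case: t => l [|[] r]. Qed.

Lemma number_pop (t : tape bool) : tape_read false t ->
  number (tape_move false MoveRight (tape_write (tape_read false t) t)) =
  (number t).-1.
Proof. by case: t => l [|[] r]. Qed.

(** The cell uncovered by the move may hold any symbol; it is overwritten. *)
Lemma number_push (t : tape bool) :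
  number (tape_write true
    (tape_move false MoveLeft (tape_write (tape_read false t) t))) =
  (number t).+1.
Proof. by case: t => l [|a r]. Qed.

Definition code_at (P : seq instr) o cs := o + size cs <= size P /\
  forall i, i < size cs -> nth (Stop false) P (o + i) = nth (Stop false) cs i.

Lemma code_at_cat P o cs1 cs2 : code_at P o (cs1 ++ cs2) ->
  code_at P o cs1 /\ code_at P (o + size cs1) cs2.
Proof.
rewrite /code_at size_cat => -[le_P Hn]; split; split; try lia.
  by move=> i lt_i; rewrite Hn; [rewrite nth_cat lt_i | lia].
move=> i lt_i; rewrite -addnA Hn; last by lia.
by rewrite nth_cat; case: ltnP; [lia | rewrite addKn].
Qed.

Definition instr_at (P : seq instr) o I := o < size P /\ nth (Stop false) P o = I.

Lemma code_at_instr P o cs i I : code_at P o cs -> i < size cs ->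
  nth (Stop false) cs i = I -> instr_at P (o + i) I.
Proof. by move=> [le_P Hn] lt_i <-; split; [lia | exact: Hn]. Qed.

Section Simulation.
Variables (k : nat) (P : seq instr) (B : set nat) (b : nat).
Let M := machine k P.
Let K := k.+2.

Definition tapes_hold (ts : K.-tuple (tape bool)) (s : nat -> nat) :=
  forall i : 'I_K, number (tnth ts i) = s i.

Definition at_pc (o : nat) (ts : K.-tuple (tape bool)) : config M :=
  @Config M (inord o : 'I_(size P).+1) ts.

Definition query_ok (c : config M) := forall yes no,
  om_action (cf_state c) = Query yes no -> query_number c <= b.

(** The queries at [c] and on the way to [c'] are bounded, but not those at [c'],
    which makes the relation transitive. *)
Definition reach (c c' : config M) := exists t,
  iter t (step B) c = c' /\ forall u, u < t -> query_ok (iter u (step B) c).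

Lemma reach_refl c : reach c c.
Proof. by exists 0. Qed.

Lemma reach_step c : query_ok c -> reach c (step B c).
Proof. by move=> ok; exists 1; split=> // -[|]. Qed.

Lemma reach_trans c1 c2 c3 : reach c1 c2 -> reach c2 c3 -> reach c1 c3.
Proof.
move=> [t1 [E1 ok1]] [t2 [E2 ok2]]; exists (t2 + t1); rewrite iterD E1 E2.
split=> // u; case: (ltnP u t1) => [/ok1 //|le_u lt_u].
by rewrite -(subnK le_u) iterD E1; apply: ok2; lia.
Qed.

Lemma action_at o I ts : instr_at P o I ->
  om_action (cf_state (at_pc o ts)) = action_of K (size P) I o.
Proof. by move=> [lt_o <-]; rewrite /= inordK // ltnW. Qed.

Lemma reach_work o I delta (ts : K.-tuple (tape bool)) q acts : instr_at P o I ->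
  action_of K (size P) I o = Work delta ->
  delta [tuple of map (tape_read false) ts] = (q, acts) ->
  reach (at_pc o ts) (@Config M q
    [tuple tape_move false (tnth acts i).2
             (tape_write (tnth acts i).1 (tnth ts i)) | i < K]).
Proof.
move=> Io EI Ed; have A := action_at ts Io; rewrite EI in A.
set c := Config _ _; have -> : c = step B (at_pc o ts).
  by rewrite /step A; move: Ed; rewrite /= => ->.
by apply: reach_step => yes no; rewrite A.
Qed.

Lemma reach_push o r ts s : instr_at P o (MoveL r) -> instr_at P o.+1 (Put r) ->
  tapes_hold ts s ->
  exists ts', reach (at_pc o ts) (at_pc o.+2 ts') /\
    tapes_hold ts' (upd s r (s r).+1).
Proof.
move=> I0 I1 Hts.
eexists; split.
  apply: reach_trans; first exact: (reach_work I0 erefl erefl).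
  exact: (reach_work I1 erefl erefl).
move=> i; rewrite !tnth_map !tnth_ord_tuple /=.
rewrite /upd; case: (eqVneq (i : nat) r) => [<-|_] /=.
  by rewrite number_push Hts.
by rewrite !number_rewrite Hts.
Qed.

Lemma reach_pop o r j ts s : instr_at P o (Pop r j) -> r < K ->
  tapes_hold ts s ->
  exists ts', reach (at_pc o ts) (at_pc (if 0 < s r then o.+1 else j) ts') /\
    tapes_hold ts' (upd s r (s r).-1).
Proof.
move=> I0 lt_r Hts.
have Er : nth false [tuple of map (tape_read false) ts] r = (0 < s r).
  rewrite -[r]/(val (Ordinal lt_r)) -tnth_nth tnth_map.
  by rewrite number_read (Hts (Ordinal lt_r)).
case: ifP Er => [s_gt0|s_eq0] Er.
  eexists; split; first by apply: (reach_work I0 erefl); rewrite Er.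
  move=> i; rewrite !tnth_mktuple /= tnth_map /upd.
  case: (eqVneq (i : nat) r) => [Ei|_] /=; last by rewrite number_rewrite Hts.
  by rewrite number_pop ?Hts -?Ei // number_read Hts Ei.
eexists; split; first by apply: (reach_work I0 erefl); rewrite Er.
move=> i; rewrite !tnth_mktuple /= tnth_map number_rewrite Hts /upd.
by case: eqP => [->|//]; case: (s r) s_eq0.
Qed.

Lemma reach_jump o j ts s : instr_at P o (Jump j) -> tapes_hold ts s ->
  exists ts', reach (at_pc o ts) (at_pc j ts') /\ tapes_hold ts' s.
Proof.
move=> I0 Hts; eexists; split; first exact: (reach_work I0 erefl erefl).
by move=> i; rewrite !tnth_mktuple /= tnth_map number_rewrite Hts.
Qed.

Lemma reach_ask o j ts s : instr_at P o (AskElse j) -> tapes_hold ts s ->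
  s query_reg <= b ->
  reach (at_pc o ts) (at_pc (if s query_reg \in B then o.+1 else j) ts).
Proof.
move=> I0 Hts le_b; have A := action_at ts I0.
have Eq : query_number (at_pc o ts) = s query_reg by rewrite /query_number Hts.
have -> : at_pc (if s query_reg \in B then o.+1 else j) ts =
    step B (at_pc o ts).
  by rewrite /step A /= -/(query_number (at_pc o ts)) Eq /at_pc; case: ifP.
by apply: reach_step => yes no _; rewrite Eq.
Qed.

(** Correctness of [code], by induction on the execution. *)
Lemma reach_exec c s s' : exec B b c s s' -> forall o ts,
  code_at P o (code c o) -> registers_below K c -> tapes_hold ts s ->
  exists ts', reach (at_pc o ts) (at_pc (o + code_size c) ts') /\
    tapes_hold ts' s'.
Proof.
elim=> {c s s'}.
- by move=> s o ts _ _ Hts; exists ts; rewrite addn0; split=> //; exact: reach_refl.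
- move=> r s o ts cd lt_r Hts; rewrite addn2.
  apply: reach_push Hts.
    by rewrite -(addn0 o); exact: (code_at_instr cd).
  by rewrite -(addn1 o); exact: (code_at_instr cd).
- move=> c1 c2 s1 s2 s3 _ IH1 _ IH2 o ts /code_at_cat[cd1 cd2] /andP[r1 r2] Hts.
  have [ts1 [R1 H1]] := IH1 _ _ cd1 r1 Hts.
  rewrite size_code in cd2; have [ts2 [R2 H2]] := IH2 _ _ cd2 r2 H1.
  by exists ts2; rewrite /= addnA; split=> //; exact: reach_trans R1 R2.
- move=> r c s s0 o ts cd /andP[lt_r _] Hts.
  have I0 : instr_at P o (Pop r (o + code_size c).+2).
    by rewrite -[X in instr_at P X _]addn0; exact: (code_at_instr cd).
  have [ts1 [R1 H1]] := reach_pop I0 lt_r Hts.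
  exists ts1; rewrite s0 /= in R1 H1 *; rewrite !addnS; split=> // i.
  by rewrite H1 /upd; case: eqP => [->|].
- move=> r c s1 s2 s3 k0 Es _ IHc _ IHl o ts cd /[dup] rl /andP[lt_r rc] Hts.
  have I0 : instr_at P o (Pop r (o + code_size c).+2).
    by rewrite -[X in instr_at P X _]addn0; exact: (code_at_instr cd).
  have [ts1 [R1 H1]] := reach_pop I0 lt_r Hts.
  rewrite Es /= in R1 H1.
  have cd' : code_at P o ([:: Pop r (o + code_size c).+2] ++ (code c o.+1 ++ [:: Jump o])).
    by rewrite cats1.
  have [_ /code_at_cat[cdc cdj]] := code_at_cat cd'.
  rewrite addn1 in cdc cdj.
  have [ts2 [R2 H2]] := IHc _ _ cdc rc H1.
  have Ij : instr_at P (o.+1 + code_size c) (Jump o).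
    rewrite -[X in instr_at P X _]addn0 -(size_code c o.+1).
    exact: (code_at_instr cdj).
  have [ts3 [R3 H3]] := reach_jump Ij H2.
  have [ts4 [R4 H4]] := IHl _ _ cd rl H3.
  exists ts4; split=> //.
  exact: reach_trans R1 (reach_trans R2 (reach_trans R3 R4)).
- move=> r s le_b o ts cd lt_r Hts.
  have I0 : instr_at P o (AskElse o.+3).
    by rewrite -[X in instr_at P X _]addn0; exact: (code_at_instr cd).
  have I1 : instr_at P o.+1 (MoveL r).
    by rewrite -(addn1 o); exact: (code_at_instr cd).
  have I2 : instr_at P o.+2 (Put r).
    by rewrite -(addn2 o); exact: (code_at_instr cd).
  have R0 := reach_ask I0 Hts le_b; rewrite addn3.
  case: ifP R0 => [_|_] R0; last by exists ts.
  have [ts1 [R1 H1]] := reach_push I1 I2 Hts.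
  by exists ts1; split=> //; exact: reach_trans R0 R1.
Qed.
End Simulation.

(** A final test of the register [out] selects the answer. A machine that has
    halted keeps its configuration, so the bound on the queries made before
    holds forever. *)
Theorem wtt_reducible_of_cmd (A B : set nat) g c out : total_recursive g ->
  (forall n, exists s, exec B (g n) c (upd (fun=> 0) 0 n) s /\
     (0 < s out) = (n \in A)) ->
  wtt_reducible A B.
Proof.
move=> rg Hc; have [K0 HK0] := registers_bounded c.
pose k := maxn K0 out; pose K := k.+2.
have HK : registers_below K c by apply: registers_belowW HK0; rewrite /K /k; lia.
have lt_out : out < K by rewrite /K /k; lia.
pose P := code c 0 ++ [:: Pop out (code_size c).+2; Stop true; Stop false].
have cd : code_at P 0 P by split=> //.
have [cdc cds] := code_at_cat cd; rewrite add0n size_code in cds.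
have Ip : instr_at P (code_size c) (Pop out (code_size c).+2).
  by rewrite -[X in instr_at _ X _]addn0; exact: (code_at_instr cds).
have It : instr_at P (code_size c).+1 (Stop true).
  by rewrite -(addn1 (code_size c)); exact: (code_at_instr cds).
have If : instr_at P (code_size c).+2 (Stop false).
  by rewrite -(addn2 (code_size c)); exact: (code_at_instr cds).
pose M := machine k P.
have halts n : exists t, om_action (cf_state (run M B n t)) = Halt (n \in A) /\
    forall u, u < t -> query_ok (g n) (run M B n u).
  have [s [Es Eout]] := Hc n.
  have [ts Ets] : exists ts, init_config M n = at_pc P 0 ts /\
      tapes_hold ts (upd (fun=> 0) 0 n).
    eexists; split.
      rewrite /init_config /at_pc; congr Config.
      by apply: val_inj; rewrite /= inordK.
    move=> i; rewrite tnth_mktuple /upd -val_eqE /=; case: eqP => //= _.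
    rewrite /tape_number /=.
    by elim: n {Es Eout} => //= n ->.
  case: Ets => E0 H0.
  have [ts1 [R1 H1]] := reach_exec Es cdc HK H0; rewrite add0n in R1.
  have [ts2 [R2 H2]] := reach_pop B (g n) Ip lt_out H1.
  have [t [Et ok]] := reach_trans R1 R2; rewrite -E0 in Et ok.
  exists t; split=> //; rewrite /run Et -Eout.
  by case: ifP => _; [rewrite (action_at _ It) | rewrite (action_at _ If)].
exists M, g; split=> //; first by move=> n; have [t [Ht _]] := halts n; exists t.
move=> n t yes no; have [T [HT ok]] := halts n.
case: (ltnP t T) => [/ok|le_Tt]; first exact.
suff -> : run M B n t = run M B n T by rewrite HT.
rewrite -(subnK le_Tt) /run iterD -/(run M B n T).
elim: (t - T) => //= d ->; by rewrite /step HT.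
Qed.

(** The oracle is consulted only for its segment of length [g n], so [g] bounds
    the queries. Since [phi] need not be total, its value may be found by an
    unbounded search, as long as the search succeeds on the segments of the given
    oracle. *)
Theorem wtt_reducible_of_segment (A B : set nat) g (phi : pfun 2) :
  total_recursive g -> partial_recursive phi ->
  (forall n, phi [tuple n; segment B (g n)] (n \in A)) -> wtt_reducible A B.
Proof.
move=> rg rphi Hphi.
have [cg Hg] := partial_recursive_implementable rg (ins := [tuple 0])
  (out := 2) (b := 6) ltac:(by case=> [[|i] lt_i]; rewrite (tnth_nth 0))
  isT ltac:(by case=> [[|i] lt_i]; rewrite (tnth_nth 0)).
have [cp Hp] := partial_recursive_implementable rphi (ins := [tuple 0; 3])
  (out := 5) (b := 6) ltac:(by case=> [[|[|i]] lt_i]; rewrite (tnth_nth 0))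
  isT ltac:(by case=> [[|[|i]] lt_i]; rewrite (tnth_nth 0)).
apply: (wtt_reducible_of_cmd (g := g) (out := 5)
  (c := Seq cg (Seq (read_segment 2 3 4) cp))) => // n.
pose s1 := upd (upd (fun=> 0) 0 n) 2 (g n).
pose s2 := upd (upd (upd s1 2 0) query_reg (g n)) 3 (segment B (g n)).
exists (upd s2 5 (n \in A)); split; last by rewrite /upd eqxx; case: (n \in A).
apply: (@exec_seq _ _ _ _ _ s1).
  apply: exec_eq (Hg B (g n) _ (g n) _ _) _.
  - by rewrite /thead (tnth_nth 0).
  - by move=> [|r].
  - by rewrite /s1; state_eq.
apply: (@exec_seq _ _ _ _ _ s2).
  by apply: exec_eq (exec_read_segment B _ _ _ _ _) _.
apply: exec_eq (Hp B (g n) _ (n \in A) _ _) _.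
- by rewrite (_ : map_tuple _ _ = [tuple n; segment B (g n)]) //; apply: val_inj.
- by case=> [|[|[|[|[|[|r]]]]]].
- by [].
Qed.

(** * Strings and their numbers *)

Lemma nat_of_stringS s : (nat_of_string s).+1 = foldl (fun a (b : bool) => a.*2 + b) 1 s.
Proof.
rewrite /nat_of_string prednK //.
by elim/last_ind: s => //= s b IHs; rewrite foldl_rcons; lia.
Qed.

Lemma nat_of_string_rcons s b :
  (nat_of_string (rcons s b)).+1 = (nat_of_string s).+1.*2 + b.
Proof. by rewrite !nat_of_stringS foldl_rcons. Qed.

Lemma nat_of_string_bounds s :
  2 ^ size s <= (nat_of_string s).+1 < 2 ^ (size s).+1.
Proof.
elim/last_ind: s => [|s b IHs] //.
rewrite nat_of_string_rcons size_rcons; move: IHs; rewrite !expnS.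
by case: b => /=; lia.
Qed.

Lemma nat_of_string_inj : injective nat_of_string.
Proof.
have E0 : nat_of_string [::] = 0 by [].
elim/last_ind => [|s b IHs] t; case/lastP: t => [//|t c] E.
- by have := nat_of_string_rcons t c; rewrite -E E0; case: c {E}; lia.
- by have := nat_of_string_rcons s b; rewrite E E0; case: b {E}; lia.
have Es := nat_of_string_rcons s b; have Et := nat_of_string_rcons t c.
rewrite E in Es; have [Est Ebc] : nat_of_string s = nat_of_string t /\ b = c.
  by case: b c Es Et {E} => -[]; lia.
by rewrite (IHs _ Est) Ebc.
Qed.

Lemma nat_of_string_surj n : exists s, nat_of_string s = n.
Proof.
elim/ltn_ind: n => -[|n] IHn; first by exists [::].
have [s Es] := IHn (n.+2./2).-1 ltac:(lia).
exists (rcons s (odd n)); apply/succn_inj.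
rewrite nat_of_string_rcons Es; have := odd_double_half n; lia.
Qed.

(** The binary logarithm of [n.+1], rounded down, in a form that is visibly
    recursive; it is the length of the string with number [n]. *)
Definition len n := \sum_(0 <= k < n) (2 ^ k.+1 <= n.+1).

Lemma len_eq l n : 2 ^ l <= n.+1 < 2 ^ l.+1 -> len n = l.
Proof.
move=> /andP[le_l lt_l].
have le_ln : l <= n by have := ltn_expl l (isT : 1 < 2); lia.
rewrite /len -[RHS](sum_ltn le_ln); apply: eq_bigr => k _; congr nat_of_bool.
apply/idP/idP => [le_k|lt_kl]; last by rewrite (leq_trans _ le_l) // leq_exp2l.
by rewrite -ltnS -(@ltn_exp2l 2) // (leq_ltn_trans le_k).
Qed.

Lemma len_nat_of_string s : len (nat_of_string s) = size s.
Proof. exact/len_eq/nat_of_string_bounds. Qed.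

Lemma len_bounds n : 2 ^ len n <= n.+1 < 2 ^ (len n).+1.
Proof.
have [s <-] := nat_of_string_surj n.
by rewrite len_nat_of_string nat_of_string_bounds.
Qed.

Lemma len_le n : len n <= n.
Proof.
by have := ltn_expl (len n) (isT : 1 < 2); have := len_bounds n; lia.
Qed.

Lemma rec_len n a : rec n a -> rec n (fun v => len (a v)).
Proof. by apply: (rec_app1 (F := len)); rewrite /len; rec_tac. Qed.

(** * Machines on unary inputs *)

(** A prefix-free code of the natural numbers; any computable bound on the length
    of the codes suffices for [dyadic_gap]. *)
Definition unary N := rcons (nseq N false) true.

Lemma size_unary N : size (unary N) = N.+1.
Proof. by rewrite size_rcons size_nseq. Qed.

Lemma nat_of_string_unary N : nat_of_string (unary N) = 2 ^ N.+1.
Proof.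
apply/succn_inj; rewrite nat_of_string_rcons.
suff -> : (nat_of_string (nseq N false)).+1 = 2 ^ N by rewrite expnS; lia.
elim: N => // N IHN; rewrite -[N.+1]addn1 nseqD cats1 nat_of_string_rcons IHN.
by rewrite expnD; lia.
Qed.

Lemma unary_inj : injective unary.
Proof. by move=> M N /(congr1 size); rewrite !size_unary => -[]. Qed.

Lemma prefix_unary M N : prefix (unary M) (unary N) -> M = N.
Proof.
rewrite /unary; elim: M N => [|M IHM] [|N] //=.
by move=> /IHM ->.
Qed.

(** The number of [unary N] is a power of 2, so [N] can be found by a search
    before [psi] is applied to it. *)
Lemma unary_machine (psi : pfun 1) : partial_recursive psi ->
  (forall v y y', psi v y -> psi v y' -> y = y') ->
  exists2 F, prefix_free_machine F &
    forall N q, psi [tuple N] (nat_of_string q) -> F (unary N) = Some q.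
Proof.
move=> rpsi fpsi.
pose R p q := exists2 N, p = unary N & psi [tuple N] (nat_of_string q).
pose F p : option (seq bool) :=
  if pselect (exists q, R p q) is left h then Some (projT1 (cid h)) else None.
have FP p q : F p = Some q <-> R p q.
  rewrite /F; case: pselect => [h|nh]; last by split=> // Rpq; case: nh; exists q.
  case: cid => q' /= Rq'; split=> [[<-]//|Rq]; congr Some.
  move: Rq' Rq => [N -> psiN] [N' /unary_inj <- psiN'].
  exact/nat_of_string_inj/(fpsi _ _ _ psiN psiN').
exists F; last by move=> N q psiN; apply/FP; exists N.
split; last first.
  move=> p q; rewrite /dom /=; case Fp: (F p) => [p'|] // _.
  case Fq: (F q) => [q'|] // _.
  by have [N -> _] := (FP _ _).1 Fp; have [M -> _] := (FP _ _).1 Fq; move/prefix_unary ->.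
pose lg : pfun 1 := fun v y => exists s,
  [/\ nth 0 v 0 == 2 ^ s.+1, forall z, z < s -> ~~ (nth 0 v 0 == 2 ^ z.+1) & y = s].
have rlg : partial_recursive lg.
  have := @rec_search 1 (fun v => nth 0 v 1 == 2 ^ (nth 0 v 0).+1) (fun v => nth 0 v 0).
  apply=> /=; last exact: rec_nth.
  by apply: rec_eqn; [rec_tac | rec_tac].
have lgP x y : lg [tuple x] y <-> x = 2 ^ y.+1.
  split=> [[s [/eqP /= -> _ -> //]]|->]; exists y; split=> //= z lt_zy.
  by rewrite eqn_exp2l //; lia.
exists (comp_pfun psi (fun _ : 'I_1 => lg)).
  by apply: partial_recursive_comp.
move=> n m; split=> [[w [hw psiw]]|[p [q [-> -> /FP[N Ep psiN]]]]].
  have /lgP En := hw ord0.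
  have [q Eq] := nat_of_string_surj m.
  exists (unary (tnth w ord0)), q; split=> //; first by rewrite nat_of_string_unary.
  apply/FP; exists (tnth w ord0) => //; rewrite Eq.
  rewrite (_ : [tuple _] = w) //; apply/eq_from_tnth => i.
  by rewrite (ord1 i) !(tnth_nth 0).
exists [tuple N]; split=> // i; rewrite (ord1 i).
by rewrite (_ : tnth _ _ = N) //; apply/lgP; rewrite Ep nat_of_string_unary.
Qed.

(** What is computable from [N] has a program of length [N + d]. *)
Lemma optimal_unary U (psi : pfun 1) : optimal U -> partial_recursive psi ->
  (forall v y y', psi v y -> psi v y' -> y = y') ->
  exists d, forall N q, psi [tuple N] (nat_of_string q) ->
    exists2 p, U p = Some q & size p <= N + d.
Proof.
move=> [_ optU] rpsi fpsi; have [F mF HF] := unary_machine rpsi fpsi.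
have [d Hd] := optU F mF; exists d.+1 => N q /HF FN.
have [|p [_ Up le_p]] := Hd (unary N); first by rewrite /dom /= FN.
by exists p; [rewrite Up | rewrite size_unary in le_p; lia].
Qed.

(** The empty string would be the only element of the domain, while an optimal
    machine takes more than one value. *)
Lemma optimal_nil U : optimal U -> U [::] = None.
Proof.
move=> optU; have [[_ pfU] _] := optU.
have [d Hd] := @optimal_unary U (fun v y => y = nth 0 v 0) optU
  (rec_nth (isT : 0 < 1)) ltac:(by move=> v y y' -> ->).
have [q0 E0] := nat_of_string_surj 0; have [q1 E1] := nat_of_string_surj 1.
have [p0 U0 _] := Hd 0 q0 E0; have [p1 U1 _] := Hd 1 q1 E1.
case Un: (U [::]) => [q|] //.
have dn : dom U [::] by rewrite /dom /= Un.
have p0E : [::] = p0 by apply: pfU; rewrite ?prefix0s // /dom /= U0.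
have p1E : [::] = p1 by apply: pfU; rewrite ?prefix0s // /dom /= U1.
move: U1 E0 E1; rewrite -p1E p0E U0 => -[->] -> //.
Qed.

(** * Enumeration of the domain *)

(** Delaying the enumeration of the number of [p] until after the value of [U]
    at [p] makes every stage [s] exceed all values found so far. *)
Lemma enumeration U : partial_recursive_string U ->
  exists X : nat -> nat -> bool,
  [/\ rec 2 (fun v => X (nth 0 v 0) (nth 0 v 1)),
      forall s s' n, s <= s' -> X s n -> X s' n,
      forall n, n \in string_set_nat (dom U) <-> exists s, X s n
    & forall s p q, U p = Some q -> X s (nat_of_string p) -> nat_of_string q < s].
Proof.
move=> [f rf Hf]; have [h [rh mh Eh]] := normal_form rf.
exists (fun s n => 0 < h [:: s; n] <= s); split.
- have rh' : rec 2 (fun v => h [:: nth 0 v 0; nth 0 v 1]).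
    exact: (rec_subst (s := [:: 0; 1]) rh).
  by rec_tac.
- move=> s s' n le_s /andP[h_gt0 h_le].
  by rewrite (mh [tuple n] s s') //= h_gt0 (leq_trans h_le).
- move=> n; rewrite inE; split=> [[p]|[s /andP[h_gt0 h_le]]].
    rewrite /dom /=; case Up: (U p) => [q|] // _ <-.
    have /Eh[t ht] : f [tuple nat_of_string p] (nat_of_string q).
      by apply/Hf; exists p, q.
    exists (maxn t (nat_of_string q).+1); rewrite (mh [tuple nat_of_string p] t) /= ?ht //.
      by rewrite leq_maxr.
    exact: leq_maxl.
  have : f [tuple n] (h [:: s; n]).-1 by apply/Eh; exists s; rewrite prednK.
  by move=> /Hf[p [q [-> _ Up]]]; exists p => //; rewrite /dom /= Up.
- move=> s p q Up /andP[h_gt0 h_le].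
  have : f [tuple nat_of_string p] (nat_of_string q) by apply/Hf; exists p, q.
  move/Eh => [t ht].
  have := mh [tuple nat_of_string p] t (maxn t s) (leq_maxl _ _).
  have := mh [tuple nat_of_string p] s (maxn t s) (leq_maxr _ _) h_gt0.
  by rewrite /= => -> ; rewrite ht => /(_ isT) E; rewrite -E.
Qed.

Local Open Scope ring_scope.
Local Open Scope classical_set_scope.

(** * Base-two expansions *)

Lemma segment_bit B N i : (i < N)%N ->
  odd (segment B N %/ 2 ^ (N - i.+1)) = (i \in B).
Proof.
elim: N => // N IHN; rewrite ltnS leq_eqVlt => /predU1P[->|lt_iN] /=.
  by rewrite subnn divn1 oddD odd_double; case: (N \in B).
rewrite subSS -(IHN lt_iN); have -> : (N - i = (N - i.+1).+1)%N by lia.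
rewrite expnS divnMA; congr (odd (_ %/ _)).
by case: (N \in B); lia.
Qed.

Lemma exp2_small (R : archiRealFieldType) (e : R) : 0 < e -> exists m, 2 ^- m < e.
Proof.
move=> e_gt0; exists (Num.truncn e^-1).+1; set k := Num.truncn _.
rewrite invf_plt ?posrE ?exprn_gt0 //.
apply: lt_le_trans (truncnS_gt e^-1) _; rewrite -/k -natrX ler_nat.
by apply: ltnW; exact: ltn_expl.
Qed.

Section Expansion.
Variables (R : realType) (A : set nat).

Let low N : R := (segment A N)%:R / 2 ^+ N.
Let up N : R := (segment A N).+1%:R / 2 ^+ N.

Lemma sum_segment N : \sum_(0 <= n < N) (n \in A)%:R / 2 ^+ n.+1 = low N.
Proof.
rewrite /low; elim: N => [|N IHN]; first by rewrite big_nil mul0r.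
rewrite big_nat_recr //= IHN natrD -muln2 natrM exprS.
by field; rewrite expf_neq0.
Qed.

Lemma low_up N : up N = low N + 2 ^- N.
Proof. by rewrite /up /low -natr1 mulrDl mul1r. Qed.

Lemma lowS N : low N.+1 = low N + (N \in A)%:R * 2 ^- N.+1.
Proof. by rewrite -!sum_segment big_nat_recr. Qed.

Lemma exp2VS N : 2 ^- N = 2 * 2 ^- N.+1 :> R.
Proof. by rewrite exprS; field; rewrite expf_neq0. Qed.

Lemma exp2V_gt0 N : 0 < 2 ^- N :> R.
Proof. by rewrite invr_gt0 exprn_gt0. Qed.

Lemma low_le N N' : (N <= N')%N -> low N <= low N'.
Proof.
move/subnK <-; elim: (N' - N)%N => //= k IHk.
apply: (le_trans IHk); rewrite addSn lowS lerDl.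
by rewrite mulr_ge0 // ltW // exp2V_gt0.
Qed.

Lemma up_leS N : up N.+1 <= up N.
Proof.
rewrite !low_up lowS (exp2VS N); have := exp2V_gt0 N.+1.
by case: (N \in A) => /=; lra.
Qed.

Lemma up_ltS N : ~ A N -> up N.+1 < up N.
Proof.
rewrite !low_up lowS (exp2VS N); have := exp2V_gt0 N.+1.
by move=> h nA; rewrite memNset //=; lra.
Qed.

Lemma up_le N N' : (N <= N')%N -> up N' <= up N.
Proof.
move/subnK <-; elim: (N' - N)%N => //= k IHk.
by apply: le_trans IHk; exact: up_leS.
Qed.

Lemma low_le_up N N' : low N <= up N'.
Proof.
apply: le_trans (low_le (leq_maxl N N')) _.
apply: le_trans (up_le (leq_maxr N N')).
by rewrite low_up lerDl ltW // exp2V_gt0.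
Qed.

(** At every zero of the expansion the upper bound drops, so [x] is less than
    each of them. *)
Lemma base_two_expansion_bounds x : base_two_expansion x A ->
  forall N, low N <= x < up N.
Proof.
move=> [cvx zeros] N.
have {}cvx : low @ \oo --> x.
  by apply: cvg_trans cvx; apply: near_eq_cvg; near=> n; rewrite sum_segment.
have cl : cvgn low by apply/cvg_ex; exists x.
have limE : lim (low @ \oo) = x by apply: cvg_lim.
apply/andP; split.
  by rewrite -limE; apply: nondecreasing_cvgn_le => // a c; exact: low_le.
have [m le_Nm nAm] := zeros N.
apply: le_lt_trans (lt_le_trans (up_ltS nAm) (up_le le_Nm)).
by rewrite -limE; apply: limr_le => //; near=> n; exact: low_le_up.
Unshelve. all: end_near. Qed.

(** If all digits from some position on were ones, the upper bounds would be
    constant from there on, and [x], being their limit, would be equal to one of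
    them. *)
Lemma bounds_base_two_expansion x :
  (forall N, low N <= x < up N) -> base_two_expansion x A.
Proof.
move=> Hx; split.
  under eq_fun do rewrite sum_segment.
  apply/cvgrPdist_lt => e e_gt0; have [m Hm] := exp2_small e_gt0.
  near=> n; have /andP[lo hi] := Hx n.
  rewrite ger0_norm ?subr_ge0 //; apply: lt_trans Hm.
  have le_m : 2 ^- n <= 2 ^- m :> R.
    rewrite lef_pV2 ?posrE ?exprn_gt0 // ler_eXn2l ?ltr1n //.
    by near: n; exact: nbhs_infty_ge.
  by rewrite low_up in hi; lra.
move=> n; apply: contrapT => all1.
have {}all1 m : (n <= m)%N -> m \in A.
  by move=> le_nm; apply: contrapT => nA; apply: all1; exists m => // /mem_set.
have upE k : up (n + k) = up n.
  elim: k => [|k IHk]; first by rewrite addn0.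
  rewrite -IHk addnS !low_up lowS (exp2VS (n + k)) all1 ?leq_addr //=; lra.
have /andP[_ ltx] := Hx n; rewrite -subr_gt0 in ltx.
have [m Hm] := exp2_small ltx.
have /andP[lo _] := Hx (n + m)%N.
have := upE m; rewrite low_up => E.
have : 2 ^- (n + m) <= 2 ^- m :> R.
  by rewrite lef_pV2 ?posrE ?exprn_gt0 // ler_eXn2l ?ltr1n // leq_addl.
lra.
Unshelve. all: end_near. Qed.
End Expansion.

(** The digits of [x] are the parities of the integer parts of
    [x * 2 ^ n.+1]. *)
Lemma real_set_bounds (R : realType) (x : R) : 0 <= x < 1 -> forall N,
  (segment (real_set x) N)%:R / 2 ^+ N <= x <
  (segment (real_set x) N).+1%:R / 2 ^+ N.
Proof.
move=> /andP[x_ge0 x_lt1]; apply: base_two_expansion_bounds.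
rewrite /real_set; apply: xgetPex.
pose A : set nat := [set n | odd (Num.truncn (x * 2 ^+ n.+1))].
have bnd N : ((Num.truncn (x * 2 ^+ N))%:R <= x * 2 ^+ N
    < (Num.truncn (x * 2 ^+ N)).+1%:R).
  by apply: truncn_itv; rewrite mulr_ge0 ?exprn_ge0.
have segE N : segment A N = Num.truncn (x * 2 ^+ N).
  elim: N => [|N IHN] /=.
    by rewrite mulr1; apply/esym/truncn_def; rewrite x_ge0 x_lt1.
  have -> : (N \in A) = odd (Num.truncn (x * 2 ^+ N.+1)).
    by apply/idP/idP => [/set_mem|?]; last exact/mem_set.
  rewrite -[RHS]odd_double_half addnC; congr (_ + _.*2)%N.
  rewrite IHN; apply: truncn_def.
  move: (bnd N.+1); set k := Num.truncn _ => /andP[lo hi].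
  have Ek := odd_double_half k; move: lo hi; rewrite -{1 2}Ek exprS.
  have : (odd k)%:R <= 1 :> R by case: (odd k).
  have : 0 <= (odd k)%:R :> R by case: (odd k).
  rewrite -[(_ + _).+1%:R]natr1 natrD -muln2 natrM -[(k./2).+1%:R]natr1 mulrCA.
  case: (odd k) => /= ? ? ? ?; apply/andP; split; lra.
exists A; apply: bounds_base_two_expansion => N; rewrite segE.
by rewrite ler_pdivrMr ?ltr_pdivlMr ?exprn_gt0.
Qed.

(** * The Kraft inequality *)

(** By induction on the maximal length: unless it contains the empty string, and
    hence no other, a prefix-free set is split by the first letter into two, and
    removing that letter leaves prefix-free sets of shorter strings. *)
Lemma kraft (R : numFieldType) (s : seq (seq bool)) : uniq s ->
  {in s &, forall p q, prefix p q -> p = q} ->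
  \sum_(p <- s) 2 ^- size p <= 1 :> R.
Proof.
have [L] : exists L, all (fun p => size p < L)%N s.
  exists (\max_(p <- s) size p).+1; apply/allP => p ps.
  by rewrite ltnS; exact: leq_bigmax_seq.
elim: L s => [|L IHL] s; first by case: s => //; rewrite big_nil.
move=> /allP sL us pf; case: (boolP ([::] \in s)) => [nil_s|nil_s].
  rewrite (bigD1_seq [::]) //= big1_seq ?addr0 ?expr0 ?invr1 // => p.
  by move=> /andP[ne_p ps]; rewrite -(pf [::] p) ?prefix0s ?eqxx in ne_p.
pose tl b := [seq behead p | p <- s & head false p == b].
have tlP b q : q \in tl b -> b :: q \in s.
  move=> /mapP[p]; rewrite mem_filter => /andP[/eqP <- ps] ->.
  by case: p ps => // /idPn; rewrite nil_s.
have tl_le b : \sum_(q <- tl b) 2 ^- size q <= 1 :> R.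
  apply: IHL => [||q r /tlP qs /tlP rs pqr].
  - by apply/allP => q /tlP /sL.
  - rewrite map_inj_in_uniq ?filter_uniq // => p q.
    rewrite !mem_filter => /andP[/eqP hp ps] /andP[/eqP hq qs].
    case: p hp ps => [|x p] /= hp ps; first by rewrite ps in nil_s.
    case: q hq qs => [|y q] /= hq qs; first by rewrite qs in nil_s.
    by rewrite hp hq => ->.
  - have E : b :: q = b :: r by apply: pf; rewrite //= eqxx.
    by case: E.
have splitE b : \sum_(p <- s | head false p == b) 2 ^- size p =
    2^-1 * \sum_(q <- tl b) 2 ^- size q :> R.
  rewrite big_map big_filter mulr_sumr big_seq_cond [RHS]big_seq_cond.
  apply: eq_bigr => -[|x p] /andP[ps _]; first by rewrite ps in nil_s.
  by rewrite /= exprS invfM.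
rewrite (bigID (fun p => head false p == true)) /= splitE.
rewrite (eq_bigl (fun p => head false p == false)); last first.
  by move=> p; case: (head false p).
rewrite splitE -mulrDr ler_pdivrMl // mulr1.
by apply: le_trans (lerD (tl_le true) (tl_le false)) _.
Qed.

Lemma kraft_numbers (R : numFieldType) (D : set (seq bool)) : prefix_free D ->
  forall N, \sum_(0 <= n < N | n \in string_set_nat D) 2 ^- len n <= 1 :> R.
Proof.
move=> pfD N; have [str strK] := choice nat_of_string_surj.
have Kstr p : str (nat_of_string p) = p by apply: nat_of_string_inj; rewrite strK.
have Dstr n : n \in string_set_nat D -> D (str n).
  by move=> /set_mem[p Dp <-]; rewrite Kstr.
pose s := [seq str n | n <- index_iota 0 N & n \in string_set_nat D].
have -> : \sum_(0 <= n < N | n \in string_set_nat D) 2 ^- len n =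
    \sum_(p <- s) 2 ^- size p :> R.
  rewrite big_map big_filter; apply: eq_bigr => n _.
  by rewrite -len_nat_of_string strK.
apply: kraft => [|p q].
  rewrite map_inj_uniq ?filter_uniq ?iota_uniq // => m n E.
  by rewrite -(strK m) E strK.
move=> /mapP[m]; rewrite mem_filter => /andP[/Dstr Dm _] ->.
move=> /mapP[n]; rewrite mem_filter => /andP[/Dstr Dn _] ->.
exact: pfD.
Qed.

(** * The weights of the strings *)

Definition weight (R : realType) (T : R) (l : nat) : R := 2 `^ (- l%:R / T).

Section Weight.
Variables (R : realType) (T : R).
Hypotheses (T_gt0 : 0 < T) (T_lt1 : T < 1).

Lemma weight_gt0 l : 0 < weight T l.
Proof. by rewrite powR_gt0. Qed.

Lemma exp2N_powR l : 2 ^- l = 2 `^ (- l%:R) :> R.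
Proof. by rewrite powRN powR_mulrn. Qed.

Lemma weight_ge : exists k, forall l, 2 ^- (k * l) <= weight T l.
Proof.
exists (Num.truncn T^-1).+1 => l; set k := Num.truncn _.
rewrite exp2N_powR; apply: ler_powR; first by rewrite ler1n.
rewrite mulNr lerN2 natrM mulrC ler_wpM2r ?ler0n //.
by rewrite ltW // truncnS_gt.
Qed.

(** [weight T l] is [2 ^- l] times the power of 2 with exponent
    [- l * (T^-1 - 1)], and [T^-1 - 1] is positive. *)
Lemma weight_le_exp2 : exists k, forall m l, (k * m <= l)%N ->
  weight T l <= 2 ^- l * 2 ^- m.
Proof.
have d_gt0 : 0 < T^-1 - 1 by rewrite subr_gt0 invf_gt1.
exists (Num.truncn (T^-1 - 1)^-1).+1 => m l; set k := Num.truncn _ => le_l.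
rewrite -invfM -exprD exp2N_powR; apply: ler_powR; first by rewrite ler1n.
rewrite mulNr lerN2 natrD.
suff : m%:R <= l%:R * (T^-1 - 1) by lra.
rewrite -ler_pdivrMr //; apply: le_trans (_ : (k.+1 * m)%:R <= _); last first.
  by rewrite ler_nat.
rewrite natrM mulrC ler_wpM2r ?ler0n //; exact/ltW/truncnS_gt.
Qed.

Lemma weight_le1 : exists2 r, r < 1 & forall l, (0 < l)%N ->
  weight T l <= 2 ^- l * r.
Proof.
have d_gt0 : 0 < T^-1 - 1 by rewrite subr_gt0 invf_gt1.
exists (2 `^ (- (T^-1 - 1))).
  rewrite -[X in _ < X](powRr0 2) /powR.
  rewrite pnatr_eq0 /= ltr_expR ltr_pM2r ?ln_gt0 ?ltr1n //; lra.
move=> l l_gt0; rewrite exp2N_powR -powRD; last by rewrite pnatr_eq0 implybT.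
apply: ler_powR; first by rewrite ler1n.
have : 1 <= l%:R :> R by rewrite ler1n.
move=> l_ge1; suff : 1 * (T^-1 - 1) <= l%:R * (T^-1 - 1) by lra.
by rewrite ler_pM2r.
Qed.
End Weight.

(** * The partition function as a series over the numbers of strings *)

Definition Zpartial (R : realType) (T : R) (X : set nat) (N : nat) : R :=
  \sum_(0 <= n < N | n \in X) weight T (len n).

Lemma Zpartial_le (R : realType) (T : R) X N N' : (N <= N')%N ->
  Zpartial T X N <= Zpartial T X N'.
Proof.
move=> le_N; rewrite /Zpartial (big_cat_nat (n := N) (leq0n N) le_N) /= lerDl.
by apply: sumr_ge0 => n _; rewrite ltW // weight_gt0.
Qed.

(** Kraft's inequality bounds a part of the series whose terms are at most
    [r] times those of the series for T = 1. *)
Lemma Zpartial_tail (R : realType) (T : R) D h r N N' : prefix_free D ->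
  0 <= r -> (forall l, (h <= l)%N -> weight T l <= 2 ^- l * r) ->
  (2 ^ h <= N.+1)%N ->
  Zpartial T (string_set_nat D) N' - Zpartial T (string_set_nat D) N <= r.
Proof.
move=> pfD r_ge0 le_r le_hN; case: (leqP N' N) => [le_N|/ltnW le_N].
  by apply: le_trans r_ge0; rewrite subr_le0 Zpartial_le.
rewrite /Zpartial (big_cat_nat (n := N) (leq0n N) le_N) /=.
rewrite addrAC subrr add0r.
have len_ge n : (N <= n)%N -> (h <= len n)%N.
  move=> le_Nn; rewrite -ltnS -(@ltn_exp2l 2) //.
  by have := len_bounds n; lia.
apply: le_trans (_ : \sum_(N <= n < N' | n \in string_set_nat D)
                       2 ^- len n * r <= _).
  rewrite big_nat_cond [leRHS]big_nat_cond; apply: ler_sum => n.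
  by move=> /andP[/andP[le_Nn _] _]; apply/le_r/len_ge.
rewrite -mulr_suml -[leRHS]mul1r ler_wpM2r //.
apply: le_trans (kraft_numbers R pfD N').
rewrite [leRHS](big_cat_nat (n := N) (leq0n N) le_N) /= lerDr.
by apply: sumr_ge0 => n _; rewrite invr_ge0 exprn_ge0.
Qed.

Lemma Zsum_cvg (R : realType) (T : R) U : has_ubound (range (Zpartial T (string_set_nat (dom U)))) ->
  Zpartial T (string_set_nat (dom U)) @ \oo --> Zsum U T.
Proof.
set X := string_set_nat (dom U) => ub.
have cv : cvgn (Zpartial T X).
  by apply: nondecreasing_is_cvgn ub => // a b; exact: Zpartial_le.
suff -> : Zsum U T = lim (Zpartial T X @ \oo) by [].
rewrite /Zsum.
have -> : (\esum_(p in dom U) (2 `^ (- (size p)%:R / T))%:E)%E =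
    (\esum_(n in X) (weight T (len n))%:E)%E.
  rewrite (reindex_esum (dom U) _ nat_of_string).
    by apply: eq_esum => p _; rewrite len_nat_of_string.
  split=> [p Up|p q _ _|n [p Up <-]]; [by exists p | | by exists p].
  exact: nat_of_string_inj.
have <- : (\sum_(n <oo | n \in X) (weight T (len n))%:E)%E =
    (\esum_(n in X) (weight T (len n))%:E)%E.
  rewrite nneseries_esum => [|n _]; last by rewrite lee_fin ltW // weight_gt0.
  by congr (esum _ _); apply/seteqP; split=> n /=; rewrite ?inE.
rewrite (_ : (fun N => _) = EFin \o Zpartial T X); last first.
  by apply/funext => N; rewrite /= sumEFin.
by rewrite EFin_lim.
Qed.

(** * Computable bounds on the weights *)

Lemma exp2V_cvg0 (R : realType) : (2 ^- n : R) @[n --> \oo] --> (0 : R).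
Proof.
apply/cvgrPdist_lt => e e_gt0; have [m Hm] := exp2_small e_gt0.
near=> n; rewrite sub0r normrN ger0_norm ?invr_ge0 ?exprn_ge0 //.
apply: le_lt_trans Hm; rewrite lef_pV2 ?posrE ?exprn_gt0 //.
by rewrite ler_eXn2l ?ltr1n //; near: n; exact: nbhs_infty_ge.
Unshelve. all: end_near. Qed.

(** The first [m] approximations are skipped, as they may be too coarse to be
    positive; the other ones give bounds that are quotients of natural numbers. *)
Lemma rational_bounds (R : realType) (T : R) : computable_real T -> 0 < T ->
  exists P P' Q : nat -> nat,
  [/\ [/\ rec 1 (fun v => P (nth 0%N v 0)), rec 1 (fun v => P' (nth 0%N v 0))
        & rec 1 (fun v => Q (nth 0%N v 0))],
      forall j, [/\ 0 < P j, 0 < P' j & 0 < Q j]%N,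
      forall j, (P j)%:R / (Q j)%:R < T < (P' j)%:R / (Q j)%:R,
      (P j)%:R / (Q j)%:R @[j --> \oo] --> T
    & (P' j)%:R / (Q j)%:R @[j --> \oo] --> T].
Proof.
move=> [a [s [p [q [rs rp rq q_neq0 Ea]]]] Ta] T_gt0.
have [m Hm] := exp2_small (divr_gt0 T_gt0 (ltr0n R 2)).
have small n : (m <= n)%N -> 2 ^- n < T / 2.
  move=> le_mn; apply: le_lt_trans Hm.
  by rewrite lef_pV2 ?posrE ?exprn_gt0 // ler_eXn2l ?ltr1n.
have qgt n : 0 < (q n)%:R :> R by rewrite ltr0n lt0n q_neq0.
have Ta' n : (m <= n)%N ->
    T - 2 ^- n < (p n)%:R / (q n)%:R < T + 2 ^- n.
  move=> le_mn; have := Ta n; have := small n le_mn.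
  have -> : ratr (a n) = (-1) ^+ s n * ((p n)%:R / (q n)%:R) :> R.
    by rewrite Ea !rmorphM fmorphV rmorphXn rmorphN rmorph1 !rmorph_nat mulrA.
  have r_ge0 : 0 <= (p n)%:R / (q n)%:R :> R by rewrite divr_ge0 // ltW.
  rewrite -signr_odd; case: (odd (s n)); rewrite ?expr0 ?expr1 ?mul1r ltr_norml => ? /andP[? ?].
    lra.
  by apply/andP; split; lra.
have e2 n : 0 < 2 ^+ n :> R by rewrite exprn_gt0.
pose t j := (p (j + m) * 2 ^ (j + m))%N.
have q_lt j : (q (j + m) < t j)%N.
  have := Ta' (j + m)%N (leq_addl _ _); have := small (j + m)%N (leq_addl _ _).
  move=> sm /andP[lo _]; have {lo sm} : 2 ^- (j + m) < (p (j + m))%:R / (q (j + m))%:R :> R.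
    by lra.
  rewrite ltr_pdivlMr // mulrC ltr_pdivrMr // => h.
  by rewrite -(ltr_nat R) /t natrM natrX.
exists (fun j => t j - q (j + m))%N, (fun j => t j + q (j + m))%N,
       (fun j => q (j + m) * 2 ^ (j + m))%N.
have Elo j : (t j - q (j + m))%:R / (q (j + m) * 2 ^ (j + m))%:R =
    (p (j + m))%:R / (q (j + m))%:R - 2 ^- (j + m) :> R.
  rewrite natrB ?(ltnW (q_lt j)) // /t !natrM !natrX.
  by field; rewrite ?gt_eqF.
have Eup j : (t j + q (j + m))%:R / (q (j + m) * 2 ^ (j + m))%:R =
    (p (j + m))%:R / (q (j + m))%:R + 2 ^- (j + m) :> R.
  rewrite natrD /t !natrM !natrX.
  by field; rewrite ?gt_eqF.
have c0 : (2 ^- (j + m) : R) @[j --> \oo] --> (0 : R).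
  by have := @exp2V_cvg0 R; rewrite -(cvg_shiftn m).
have c2 : (2 * 2 ^- (j + m) : R) @[j --> \oo] --> (0 : R).
  by rewrite -[X in _ --> X](mulr0 (2 : R)); exact: cvgMr.
have rjm : rec 1 (fun v => nth 0 v 0 + m)%N by rec_tac.
have rp' : rec 1 (fun v => p (nth 0 v 0 + m))%N.
  by apply: rec_app1 rjm; exact/total_recursiveP.
have rq' : rec 1 (fun v => q (nth 0 v 0 + m))%N.
  by apply: rec_app1 rjm; exact/total_recursiveP.
split.
- by split; rewrite /t; rec_tac.
- move=> j; have lt_j := q_lt j; rewrite subn_gt0 lt_j addn_gt0 muln_gt0.
  by rewrite expn_gt0 [(0 < q _)%N]lt0n q_neq0 orbT.
- move=> j; rewrite Elo Eup; have /andP[? ?] := Ta' (j + m)%N (leq_addl _ _).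
  by apply/andP; split; lra.
- under eq_fun do rewrite Elo.
  apply: (@squeeze_cvgr _ _ _ _ (fun j => T - 2 * 2 ^- (j + m)) (fun=> T)).
  + near=> j; have /andP[? ?] := Ta' (j + m)%N (leq_addl _ _).
    by apply/andP; split; lra.
  + by rewrite -[X in _ --> X](subr0 T); apply: cvgB => //; exact: cvg_cst.
  + exact: cvg_cst.
- under eq_fun do rewrite Eup.
  apply: (@squeeze_cvgr _ _ _ _ (fun=> T) (fun j => T + 2 * 2 ^- (j + m))).
  + near=> j; have /andP[? ?] := Ta' (j + m)%N (leq_addl _ _).
    by apply/andP; split; lra.
  + exact: cvg_cst.
  + by rewrite -[X in _ --> X](addr0 T); apply: cvgD => //; exact: cvg_cst.
Unshelve. all: end_near. Qed.

Lemma weight_cvg (R : realType) (T : R) l (t : nat -> R) : 0 < T ->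
  t @ \oo --> T -> weight (t j) l @[j --> \oo] --> weight T l.
Proof.
move=> T_gt0 ct; rewrite /weight /powR pnatr_eq0 /=.
apply: (@continuous_cvg _ _ _ _ _ _ (@expR R)); first exact: continuous_expR.
apply: cvgMl; apply: cvgMr; apply: cvgV => //; exact: lt0r_neq0.
Qed.

Lemma weight_homo (R : realType) (t t' : R) l : 0 < t -> t <= t' ->
  weight t l <= weight t' l.
Proof.
move=> t_gt0 le_t; apply: ler_powR; first by rewrite ler1n.
rewrite !mulNr lerN2 ler_wpM2l // lef_pV2 // posrE //.
exact: lt_le_trans le_t.
Qed.

(** The integer part of [2 ^ s * weight (P / Q) l]: raising the inequality
    [c.+1 <= 2 ^ s * weight (P / Q) l] to the power [P] leaves only natural
    exponents. *)
Definition trunc_weight l s P Q : nat :=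
  \sum_(0 <= c < 2 ^ s) (c.+1 ^ P * 2 ^ (l * Q) <= 2 ^ (s * P)).

Lemma trunc_weightE (R : realType) l s P Q : (0 < P)%N -> (0 < Q)%N ->
  trunc_weight l s P Q =
  Num.truncn (2 ^+ s * weight (P%:R / Q%:R : R) l).
Proof.
move=> P_gt0 Q_gt0; set w := weight _ l.
have w_ge0 : 0 <= w by rewrite ltW // weight_gt0.
have wP : w ^+ P * 2 ^+ (l * Q) = 1.
  have -> : w ^+ P = 2 ^- (l * Q).
    rewrite /w /weight -powR_mulrn // -powRrM exp2N_powR natrM; congr (_ `^ _).
    by field; rewrite !pnatr_eq0; lia.
  by rewrite mulVf // expf_neq0.
rewrite -[RHS](@sum_ltn _ (2 ^ s)).
  apply: eq_bigr => c _; congr nat_of_bool.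
  rewrite truncn_gt_nat -(@ler_pXn2r _ P) ?nnegrE ?mulr_ge0 ?exprn_ge0 //.
  rewrite exprMn -(@ler_pM2r _ (2 ^+ (l * Q))) ?exprn_gt0 //.
  by rewrite -mulrA wP mulr1 -exprM -!natrX -natrM ler_nat.
rewrite -ltnS -(ltr_nat R); set x := _ * w.
have x_ge0 : 0 <= x by rewrite mulr_ge0 ?exprn_ge0.
have /andP[lo _] := truncn_itv x_ge0.
apply: le_lt_trans lo _; rewrite -[(2 ^ s).+1%:R]natr1 natrX.
have : w <= 1.
  rewrite -(powRr0 2); apply: ler_powR; first by rewrite ler1n.
  by rewrite mulNr oppr_le0 divr_ge0 // divr_ge0.
have : 0 < 2 ^+ s :> R by rewrite exprn_gt0.
by rewrite /x => ? ?; have : 2 ^+ s * w <= 2 ^+ s * 1; [rewrite ler_pM2l | lra].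
Qed.

(** The weights are increasing and continuous in T, so they are evaluated at
    rational bounds of T. *)
Lemma weight_bounds (R : realType) (T : R) : computable_real T -> 0 < T ->
  exists lo up : nat -> nat -> nat,
  [/\ rec 2 (fun v => lo (nth 0%N v 0) (nth 0%N v 1)),
      rec 2 (fun v => up (nth 0%N v 0) (nth 0%N v 1)),
      forall l s, (lo l s)%:R / 2 ^+ s <= weight T l <= (up l s)%:R / 2 ^+ s,
      forall l, (lo l s)%:R / 2 ^+ s @[s --> \oo] --> weight T l
    & forall l, (up l s)%:R / 2 ^+ s @[s --> \oo] --> weight T l].
Proof.
move=> cT T_gt0.
have [P [P' [Q [[rP rP' rQ] pos PQ cP cP']]]] := rational_bounds cT T_gt0.
exists (fun l s => trunc_weight l s (P s) (Q s)),
       (fun l s => (trunc_weight l s (P' s) (Q s)).+1).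
have rtw (p : nat -> nat) : rec 1 (fun v => p (nth 0%N v 0)) ->
    rec 2 (fun v => trunc_weight (nth 0%N v 0) (nth 0%N v 1)
                      (p (nth 0%N v 1)) (Q (nth 0%N v 1))).
  move=> rp; rewrite /trunc_weight.
  have rp' n k : (k < n)%N -> rec n (fun v => p (nth 0%N v k)).
    by move=> lt_k; apply: rec_app1 (rec_nth lt_k).
  have rQ' n k : (k < n)%N -> rec n (fun v => Q (nth 0%N v k)).
    by move=> lt_k; apply: rec_app1 (rec_nth lt_k).
  have rpb : rec 3 (fun v => p (nth 0%N (behead v) 1)).
    by apply: (rec_behead (f := fun v => p (nth 0%N v 1))); exact: rp'.
  have rQb : rec 3 (fun v => Q (nth 0%N (behead v) 1)).
    by apply: (rec_behead (f := fun v => Q (nth 0%N v 1))); exact: rQ'.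
  by rec_tac.
have e2 s : 0 < 2 ^+ s :> R by rewrite exprn_gt0.
have tw p s l : (0 < p)%N ->
    (trunc_weight l s p (Q s))%:R / 2 ^+ s <= weight (p%:R / (Q s)%:R : R) l <
    (trunc_weight l s p (Q s)).+1%:R / 2 ^+ s.
  move=> p_gt0; set x := weight _ l; have [_ _ Q_gt0] := pos s.
  have := @truncn_itv _ (2 ^+ s * x); rewrite (trunc_weightE R) //.
  rewrite ler_pdivrMr // ltr_pdivlMr // mulrC; apply.
  by rewrite mulr_ge0 // ltW // weight_gt0.
have lo_bnd l s : (trunc_weight l s (P s) (Q s))%:R / 2 ^+ s <=
    weight ((P s)%:R / (Q s)%:R : R) l <=
    (trunc_weight l s (P s) (Q s))%:R / 2 ^+ s + 2 ^- s.
  have [P_gt0 _ _] := pos s; have /andP[-> /ltW] := tw (P s) s l P_gt0.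
  by rewrite -[(trunc_weight _ _ _ _).+1%:R]natr1 mulrDl mul1r.
have up_bnd l s : (trunc_weight l s (P' s) (Q s)).+1%:R / 2 ^+ s - 2 ^- s <=
    weight ((P' s)%:R / (Q s)%:R : R) l <=
    (trunc_weight l s (P' s) (Q s)).+1%:R / 2 ^+ s.
  have [_ P_gt0 _] := pos s; have /andP[+ /ltW ->] := tw (P' s) s l P_gt0.
  by rewrite -[(trunc_weight _ _ _ _).+1%:R]natr1 mulrDl mul1r addrK => ->.
split.
- exact: rtw.
- exact/rec_succ/rtw.
- move=> l s; have /andP[/ltW le_T /ltW ge_T] := PQ s; have [? ? ?] := pos s.
  have /andP[b1 _] := lo_bnd l s; have /andP[_ b2] := up_bnd l s.
  apply/andP; split; [apply: le_trans b1 _ | apply: le_trans _ b2].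
    by apply: weight_homo => //; rewrite divr_gt0 ?ltr0n.
  exact: weight_homo.
- move=> l; apply: (@squeeze_cvgr _ _ _ _
    (fun s => weight ((P s)%:R / (Q s)%:R) l - 2 ^- s)
    (fun s => weight ((P s)%:R / (Q s)%:R) l)).
  + near=> s; have /andP[? ?] := lo_bnd l s.
    by apply/andP; split; lra.
  + rewrite -[X in _ --> X]subr0; apply: cvgB (@exp2V_cvg0 R).
    exact: weight_cvg.
  + exact: weight_cvg.
- move=> l; apply: (@squeeze_cvgr _ _ _ _
    (fun s => weight ((P' s)%:R / (Q s)%:R) l)
    (fun s => weight ((P' s)%:R / (Q s)%:R) l + 2 ^- s)).
  + near=> s; have /andP[? ?] := up_bnd l s.
    by apply/andP; split; lra.
  + exact: weight_cvg.
  + rewrite -[X in _ --> X]addr0; apply: cvgD (@exp2V_cvg0 R).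
    exact: weight_cvg.
Unshelve. all: end_near. Qed.

(** * The two reductions *)

Section Reductions.
Variables (R : realType) (T : R) (U : string_pfun).
Hypotheses (optU : optimal U) (T_gt0 : 0 < T) (T_lt1 : T < 1).

Let D := string_set_nat (dom U).
Let Z := Zsum U T.

(** As the empty string is not in the domain, all weights gain a common factor
    [r] over those for T = 1. *)
Lemma Zpartial_lt1 : exists2 r, r < 1 & forall N, Zpartial T D N <= r.
Proof.
have [[_ pfU] _] := optU; have [r r_lt1 Hr] := weight_le1 T_gt0 T_lt1.
have r_ge0 : 0 <= r.
  have := le_trans (ltW (weight_gt0 T 1)) (Hr 1%N isT).
  by rewrite pmulr_rge0 // invr_gt0 exprn_gt0.
exists r => // N; have := Zpartial_tail (N := 1) N pfU r_ge0 Hr isT.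
rewrite [X in _ - X]/Zpartial big_mkcond big_nat1 ifF ?subr0 //.
apply/negP => /set_mem[p Up E0]; move: Up; rewrite /dom /=.
by rewrite (_ : p = [::]) ?optimal_nil //; exact: nat_of_string_inj.
Qed.

Lemma Zpartial_cvg : Zpartial T D @ \oo --> Z.
Proof.
apply: Zsum_cvg; have [r _ Hr] := Zpartial_lt1.
by exists r => _ [N _ <-]; exact: Hr.
Qed.

Lemma Zpartial_le_Zsum N : Zpartial T D N <= Z.
Proof.
have <- : lim (Zpartial T D @ \oo) = Z by apply: cvg_lim Zpartial_cvg.
apply: nondecreasing_cvgn_le; first by move=> a b; exact: Zpartial_le.
by apply/cvg_ex; exists Z; exact: Zpartial_cvg.
Qed.

Lemma Zsum_le x : (forall N, Zpartial T D N <= x) -> Z <= x.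
Proof.
move=> Hx; have <- : lim (Zpartial T D @ \oo) = Z by apply: cvg_lim Zpartial_cvg.
apply: limr_le; first by apply/cvg_ex; exists Z; exact: Zpartial_cvg.
exact: nearW.
Qed.

Lemma Zsum_itv : 0 <= Z < 1.
Proof.
have [r r_lt1 Hr] := Zpartial_lt1; apply/andP; split.
  by apply: le_trans (Zpartial_le_Zsum 0); rewrite /Zpartial big_geq.
by apply: le_lt_trans r_lt1; exact: Zsum_le.
Qed.

Variables (X : nat -> nat -> bool) (lo up : nat -> nat -> nat) (k : nat).
Hypotheses (rX : rec 2 (fun v => X (nth 0%N v 0) (nth 0%N v 1)))
  (X_mono : forall s s' n, (s <= s')%N -> X s n -> X s' n)
  (XP : forall n, n \in D <-> exists s, X s n)
  (X_val : forall s p q, U p = Some q -> X s (nat_of_string p) ->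
     (nat_of_string q < s)%N)
  (rlo : rec 2 (fun v => lo (nth 0%N v 0) (nth 0%N v 1)))
  (rup : rec 2 (fun v => up (nth 0%N v 0) (nth 0%N v 1)))
  (lo_up : forall l s,
     (lo l s)%:R / 2 ^+ s <= weight T l <= (up l s)%:R / 2 ^+ s)
  (lo_cvg : forall l, (lo l s)%:R / 2 ^+ s @[s --> \oo] --> weight T l)
  (up_cvg : forall l, (up l s)%:R / 2 ^+ s @[s --> \oo] --> weight T l)
  (kP : forall l, 2 ^- (k * l) <= weight T l).

Lemma rec_X n a b : rec n a -> rec n b -> rec n (fun v => X (a v) (b v) : nat).
Proof. exact: (rec_app2 (F := fun s n => nat_of_bool (X s n))). Qed.

Lemma rec_lo n a b : rec n a -> rec n b -> rec n (fun v => lo (a v) (b v)).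
Proof. exact: rec_app2. Qed.

Lemma rec_up n a b : rec n a -> rec n b -> rec n (fun v => up (a v) (b v)).
Proof. exact: rec_app2. Qed.

Ltac rec_all := repeat first
  [ rec_step | apply: rec_X | apply: rec_lo | apply: rec_up | apply: rec_len ].

(** The denominator [2 ^ s] is left out, so that the sum is a natural number. *)
Definition Zlow s := (\sum_(0 <= n < s) X s n * lo (len n) s)%N.

Lemma rec_Zlow n a : rec n a -> rec n (fun v => Zlow (a v)).
Proof. by apply: (rec_app1 (F := Zlow)); rewrite /Zlow; rec_all. Qed.

Lemma exp2_gt0 n : 0 < 2 ^+ n :> R.
Proof. by rewrite exprn_gt0. Qed.

(** A string missing at stage [s] leaves room for its weight. *)
Lemma Zlow_missing s n : n \in D -> ~~ X s n ->
  (Zlow s)%:R / 2 ^+ s + weight T (len n) <= Z.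
Proof.
move=> Dn Xn; set M := maxn s n.+1.
have w_ge0 i : 0 <= weight T (len i) by exact/ltW/weight_gt0.
have le_low : (Zlow s)%:R / 2 ^+ s <=
    \sum_(0 <= i < M) (X s i)%:R * weight T (len i).
  rewrite /Zlow natr_sum mulr_suml.
  apply: le_trans (_ : \sum_(0 <= i < s) (X s i)%:R * weight T (len i) <= _).
    apply: ler_sum => i _; rewrite natrM -mulrA ler_wpM2l //.
    by have /andP[] := lo_up (len i) s.
  rewrite [leRHS](big_cat_nat (n := s) (leq0n s) (leq_maxl _ _)) /= lerDl.
  by apply: sumr_ge0 => i _; rewrite mulr_ge0.
have Ew : weight T (len n) = \sum_(0 <= i < M) (i == n)%:R * weight T (len i).
  rewrite (bigD1_seq n) ?iota_uniq ?mem_index_iota ?leq_maxr //= eqxx mul1r.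
  by rewrite big1 ?addr0 // => i /negbTE ->; rewrite mul0r.
apply: le_trans (Zpartial_le_Zsum M); rewrite {}Ew.
apply: le_trans (lerD le_low (lexx _)) _; rewrite -big_split /=.
rewrite /Zpartial [leRHS]big_mkcond; apply: ler_sum => i _.
rewrite -mulrDl; have [->|ne_i] := eqVneq i n; first by rewrite (negbTE Xn) Dn add0r mul1r.
rewrite addr0; case Xi: (X s i); last by rewrite mul0r; case: ifP.
by rewrite mul1r ifT //; apply/XP; exists s.
Qed.

(** Some finite part of the series exceeds [x]. From some stage on, all of its
    strings have been found, and the lower bounds of their weights converge. *)
Lemma Zlow_cofinal x : x < Z -> exists s, x < (Zlow s)%:R / 2 ^+ s.
Proof.
move=> lt_x; have [N lt_xN] : exists N, x < Zpartial T D N.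
  apply: contrapT => nex; suff : Z <= x by lra.
  by apply: Zsum_le => N; rewrite leNgt; apply/negP => ?; apply: nex; exists N.
have cN : (\sum_(0 <= n < N | n \in D) (lo (len n) s)%:R / 2 ^+ s)
    @[s --> \oo] --> Zpartial T D N.
  by apply: cvg_big => [|n _]; [exact: add_continuous | exact: lo_cvg].
have found n : \forall s \near \oo, n \in D -> X s n.
  have [Dn|nDn] := boolP (n \in D); last exact: nearW.
  have [s0 Xs0] := (XP n).1 Dn.
  by near=> s; move=> _; apply: X_mono Xs0; near: s; exact: nbhs_infty_ge.
have {}found : \forall s \near \oo, forall n, (n < N)%N -> n \in D -> X s n.
  elim: N {lt_xN cN} => [|N IHN]; first exact: nearW.
  near=> s => n; rewrite ltnS leq_eqVlt => /predU1P[->|].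
    by near: s; exact: found.
  by move: n; near: s.
have [s [le_N lt_s Hs]] : exists s, [/\ (N <= s)%N,
    x < \sum_(0 <= n < N | n \in D) (lo (len n) s)%:R / 2 ^+ s
    & forall n, (n < N)%N -> n \in D -> X s n].
  near \oo => s; exists s; split.
  - by near: s; exact: nbhs_infty_ge.
  - by near: s; exact: cvgr_gt cN _ lt_xN.
  - by near: s.
exists s; apply: lt_le_trans lt_s _.
rewrite /Zlow natr_sum mulr_suml [leRHS](big_cat_nat (n := N) (leq0n N) le_N) /=.
apply: le_trans (_ : \sum_(0 <= i < N) (X s i * lo (len i) s)%N%:R / 2 ^+ s <= _); last first.
  by rewrite lerDl; apply: sumr_ge0 => i _; rewrite divr_ge0 ?exprn_ge0.
rewrite big_mkcond big_nat_cond [leRHS]big_nat_cond.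
apply: ler_sum => i /andP[/andP[_ lt_iN] _]; case: ifP => [Di|_].
  by rewrite Hs // mul1n.
by rewrite divr_ge0 ?exprn_ge0.
Unshelve. all: end_near. Qed.

(** The lower bound of stage [s] exceeds [a / 2 ^ l - 2 ^- m], with the
    denominators cleared. *)
Definition close a l m s : bool :=
  (a * 2 ^ m * 2 ^ s < Zlow s * 2 ^ l * 2 ^ m + 2 ^ l * 2 ^ s)%N.

Lemma closeE a l m s :
  close a l m s = (a%:R / 2 ^+ l - 2 ^- m < (Zlow s)%:R / 2 ^+ s :> R).
Proof.
rewrite /close ltrBlDr -(ltr_nat R) natrD !natrM !natrX.
have el := exp2_gt0 l; have em := exp2_gt0 m; have es := exp2_gt0 s.
rewrite -[RHS](ltr_pM2r (mulr_gt0 (mulr_gt0 el em) es)).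
by congr (_ < _); field; rewrite ?gt_eqF.
Qed.

Lemma rec_close n a l m s : rec n a -> rec n l -> rec n m -> rec n s ->
  rec n (fun v => close (a v) (l v) (m v) (s v)).
Proof.
move=> ra rl rm rs; rewrite /close.
by repeat first [apply: rec_Zlow | rec_step].
Qed.

Lemma ex_close a l m : a%:R / 2 ^+ l - 2 ^- m < Z -> exists s,
  close a l m s /\ forall z, (z < s)%N -> ~~ close a l m z.
Proof.
move=> lt_Z; apply: ex_least; have [s Hs] := Zlow_cofinal lt_Z.
by exists s; rewrite closeE.
Qed.

(** * From the partition function to the domain *)

(** The first [g n] bits of Z determine it so closely that the search for a
    lower bound compatible with them succeeds, and ends at a stage at which no
    string of the length of the one numbered [n] can be missing. *)
Theorem domain_wtt_Zsum : wtt_reducible D (real_set Z).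
Proof.
pose g n := (k * n).+1.
pose phi : pfun 2 := fun v y => exists s,
  [/\ close (nth 0 v 1) (g (nth 0 v 0)) (g (nth 0 v 0)) s,
      forall z, (z < s)%N ->
        ~~ close (nth 0 v 1) (g (nth 0 v 0)) (g (nth 0 v 0)) z
    & y = X s (nth 0 v 0)]%N.
have rphi : partial_recursive phi.
  apply: (@rec_search 2
    (fun v => close (nth 0 v 2) (g (nth 0 v 1)) (g (nth 0 v 1)) (nth 0 v 0))%N
    (fun v => X (nth 0 v 0) (nth 0 v 1))%N); rewrite /g;
  by repeat first [apply: rec_close | rec_step | apply: rec_X].
apply: (wtt_reducible_of_segment (g := g)) rphi _.
  by apply/total_recursiveP; rewrite /g; rec_all.
move=> n; set c := segment _ _.
have /andP[c_le c_gt] := real_set_bounds Zsum_itv (g n).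
rewrite -/c -/Z in c_le c_gt.
have eg : 0 < 2 ^- g n :> R by rewrite invr_gt0 exp2_gt0.
have [|s [cs min_s]] := @ex_close c (g n) (g n); first by lra.
exists s; split=> //=.
congr nat_of_bool; apply/idP/idP => [Dn|Xn]; last by apply/XP; exists s.
apply: contraT => nX; have := Zlow_missing Dn nX; rewrite closeE in cs.
have le_w : 2 ^- (k * n) <= weight T (len n).
  apply: le_trans (kP _); rewrite lef_pV2 ?posrE ?exp2_gt0 //.
  by rewrite ler_eXn2l ?ltr1n // leq_mul2l len_le orbT.
have E2 : 2 ^- (k * n) = 2 * 2 ^- g n :> R by rewrite /g exp2VS.
have Ec : c.+1%:R / 2 ^+ g n = c%:R / 2 ^+ g n + 2 ^- g n :> R.
  by rewrite -[c.+1%:R]natr1 mulrDl mul1r.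
by rewrite Ec in c_gt; lra.
Qed.

(** * From the domain to the partition function *)

(** Every [a / 2 ^ l] with [a < 2 ^ l] is [dyadic N] for [N = 2 ^ l + a - 1]. *)
Definition dyadic N : R := (N.+1 - 2 ^ len N)%N%:R / 2 ^+ len N.

(** If Z were too close to [dyadic N], the least stage at which the lower bound
    is close to [dyadic N] would be computable from [N], and hence the value of
    [U] at a string of length at most [N + d]. That string is missing at this
    stage, as the values found by a stage are less than it; but its weight is
    more than the distance that the lower bound has left to Z. *)
Lemma dyadic_gap : exists d, forall N, (d <= N)%N ->
  2 ^- (k * (N + N)).+1 <= `|Z - dyadic N|.
Proof.
pose m N := (k * (N + N)).+1.
pose closeN N := close (N.+1 - 2 ^ len N)%N (len N) (m N).
pose psi : pfun 1 := fun v y => exists s, [/\ closeN (nth 0 v 0) s,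
  forall z, (z < s)%N -> ~~ closeN (nth 0 v 0) z & y = s]%N.
have rpsi : partial_recursive psi.
  apply: (@rec_search 1 (fun v => closeN (nth 0 v 1) (nth 0 v 0))%N
    (fun v => nth 0 v 0)%N); rewrite /closeN /m;
  by repeat first [apply: rec_close | rec_step | apply: rec_len].
have fpsi v y y' : psi v y -> psi v y' -> y = y'.
  move=> [s [cs ms ->]] [s' [cs' ms' ->]].
  by case: (ltngtP s s') => // [/ms'|/ms]; rewrite ?cs ?cs'.
have [d Hd] := optimal_unary optU rpsi fpsi.
exists d => N le_dN; rewrite leNgt; apply/negP.
rewrite -/(m N) ltr_distl => /andP[lo_Z up_Z].
have [s [cs min_s]] := ex_close lo_Z.
have [q Eq] := nat_of_string_surj s.
have [|p Up le_p] := Hd N q; first by rewrite Eq; exists s.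
have Dp : nat_of_string p \in D by apply/mem_set; exists p; rewrite // /dom /= Up.
have nX : ~~ X s (nat_of_string p).
  by apply/negP => /(X_val Up); rewrite Eq ltnn.
have := Zlow_missing Dp nX; rewrite len_nat_of_string.
rewrite closeE -/(dyadic N) in cs.
have le_w : 2 ^- (k * (N + N)) <= weight T (size p).
  apply: le_trans (kP _); rewrite lef_pV2 ?posrE ?exp2_gt0 //.
  by rewrite ler_eXn2l ?ltr1n // leq_mul2l; apply/orP; right; lia.
have := exp2VS R (k * (N + N)); rewrite -/(m N) => E2.
lra.
Qed.

Lemma dyadic_gap_level : exists d, forall l a, (d <= l)%N -> (a < 2 ^ l)%N ->
  2 ^- (k * 2 ^ l.+2).+1 <= `|Z - a%:R / 2 ^+ l|.
Proof.
have [d Hd] := dyadic_gap; exists d => l a le_dl lt_a.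
have lt_l := ltn_expl l (isT : 1 < 2)%N.
pose N := (2 ^ l + a).-1.
have EN : N.+1 = (2 ^ l + a)%N by rewrite /N; lia.
have El : len N = l by apply: len_eq; rewrite EN expnS; lia.
have := Hd N ltac:(lia); rewrite /dyadic El EN addKn; apply: le_trans.
rewrite lef_pV2 ?posrE ?exp2_gt0 // ler_eXn2l ?ltr1n // ltnS leq_mul2l.
by apply/orP; right; rewrite !expnS; lia.
Qed.

(** The strings with numbers below [g n] account for Z up to less than the margin
    that separates Z from the multiples of [2 ^- lv n]. So their part [W] of the
    sum lies between the same two multiples as Z, and strictly so; hence
    sufficiently good bounds on [W] show between which ones. The level is
    [n + d + 1] rather than [n + 1] because the margin is known only from level
    [d] on. *)
Theorem Zsum_wtt_domain : wtt_reducible (real_set Z) D.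
Proof.
have [d Hd] := dyadic_gap_level; have [kk Hkk] := weight_le_exp2 T_gt0 T_lt1.
pose lv n := (n + d).+1; pose M n := (k * 2 ^ (lv n).+2).+1.
pose g n := (2 ^ (kk * (M n).+1))%N.
pose bit c G i : nat := odd (c %/ 2 ^ (G - i.+1)).
pose Wlo n c s := (\sum_(0 <= i < g n) bit c (g n) i * lo (len i) s)%N.
pose Wup n c s := (\sum_(0 <= i < g n) bit c (g n) i * up (len i) s)%N.
pose a n c s := (Wlo n c s * 2 ^ lv n %/ 2 ^ s)%N.
pose ok n c s := (Wup n c s * 2 ^ lv n < (a n c s).+1 * 2 ^ s)%N.
pose phi : pfun 2 := fun v y => exists s,
  [/\ ok (nth 0 v 0) (nth 0 v 1) s,
      forall z, (z < s)%N -> ~~ ok (nth 0 v 0) (nth 0 v 1) z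
    & y = odd (a (nth 0 v 0) (nth 0 v 1) s %/ 2 ^ d)]%N.
have rg n b : rec n b -> rec n (fun v => g (b v)).
  by apply: (rec_app1 (F := g)); rewrite /g /M /lv; rec_all.
have rbit n b1 b2 b3 : rec n b1 -> rec n b2 -> rec n b3 ->
    rec n (fun v => bit (b1 v) (b2 v) (b3 v)).
  apply: (rec_app3 (F := bit)); rewrite /bit; rec_all.
  by move=> v; rewrite expn_gt0.
have rWlo n b1 b2 b3 : rec n b1 -> rec n b2 -> rec n b3 ->
    rec n (fun v => Wlo (b1 v) (b2 v) (b3 v)).
  apply: (rec_app3 (F := Wlo)); rewrite /Wlo.
  by repeat first [apply: rg | apply: rbit | rec_step | apply: rec_lo | apply: rec_len].
have rWup n b1 b2 b3 : rec n b1 -> rec n b2 -> rec n b3 ->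
    rec n (fun v => Wup (b1 v) (b2 v) (b3 v)).
  apply: (rec_app3 (F := Wup)); rewrite /Wup.
  by repeat first [apply: rg | apply: rbit | rec_step | apply: rec_up | apply: rec_len].
have ra n b1 b2 b3 : rec n b1 -> rec n b2 -> rec n b3 ->
    rec n (fun v => a (b1 v) (b2 v) (b3 v)).
  apply: (rec_app3 (F := a)); rewrite /a /lv.
  repeat first [apply: rWlo | rec_step].
  by move=> v; rewrite expn_gt0.
have rphi : partial_recursive phi.
  apply: (@rec_search 2
    (fun v => ok (nth 0 v 1) (nth 0 v 2) (nth 0 v 0))%N
    (fun v => odd (a (nth 0 v 1) (nth 0 v 2) (nth 0 v 0) %/ 2 ^ d))%N).
    by rewrite /ok /lv; repeat first [apply: rWup | apply: ra | rec_step].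
  repeat first [apply: ra | rec_step].
  by move=> v; rewrite expn_gt0.
apply: (wtt_reducible_of_segment (g := g)) rphi _.
  by apply/total_recursiveP; apply: rg; rec_all.
move=> n; set c := segment _ _; set W := Zpartial T D (g n).
have e_gt0 j : 0 < 2 ^- j :> R by rewrite invr_gt0 exp2_gt0.
have W_le : W <= Z := Zpartial_le_Zsum (g n).
have Z_lt : Z < W + 2 ^- M n.
  have [[_ pfU] _] := optU.
  have Z_le : Z <= W + 2 ^- (M n).+1.
    apply: Zsum_le => N; rewrite addrC -lerBlDr.
    apply: Zpartial_tail pfU _ _ (leqnSn _); first exact: ltW.
    by move=> l le_l; exact: Hkk.
  by apply: le_lt_trans Z_le _; rewrite ltrD2l (exp2VS _ (M n)); have := e_gt0 (M n).+1; lra.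
have /andP[_ Z_lt1] := Zsum_itv.
have lvl_gt0 := exp2_gt0 (lv n).
(* No multiple of 2 ^- lv n lies between W and Z. *)
have no_dyadic b : W <= b%:R / 2 ^+ lv n -> b%:R / 2 ^+ lv n <= Z -> False.
  move=> le_Wb le_bZ.
  have lt_b : (b < 2 ^ lv n)%N.
    rewrite -(ltr_nat R) natrX -[ltRHS]mul1r -ltr_pdivrMr //.
    exact: le_lt_trans Z_lt1.
  have le_d : (d <= lv n)%N by rewrite leqW // leq_addl.
  have := Hd (lv n) b le_d lt_b.
  rewrite -/(M n) ger0_norm ?subr_ge0 //; lra.
have bitE i : (i < g n)%N -> bit c (g n) i = (i \in D).
  by move=> lt_i; rewrite /bit segment_bit.
have WE (f : nat -> nat -> nat) s :
    (\sum_(0 <= i < g n) bit c (g n) i * f (len i) s)%N%:R / 2 ^+ s =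
    \sum_(0 <= i < g n | i \in D) (f (len i) s)%:R / 2 ^+ s :> R.
  rewrite natr_sum mulr_suml [RHS]big_mkcond [LHS]big_nat_cond [RHS]big_nat_cond.
  apply: eq_bigr => i /andP[/andP[_ lt_i] _]; rewrite natrM bitE //.
  by case: ifP => _; rewrite ?mul1r ?mul0r.
have Wlo_le s : (Wlo n c s)%:R / 2 ^+ s <= W.
  rewrite WE; apply: ler_sum => i _.
  by have /andP[] := lo_up (len i) s.
have Wup_ge s : W <= (Wup n c s)%:R / 2 ^+ s.
  rewrite WE; apply: ler_sum => i _.
  by have /andP[] := lo_up (len i) s.
have ex : exists s, ok n c s.
  pose a0 := Num.truncn (W * 2 ^+ lv n).
  have W_ge0 : 0 <= W.
    by apply: sumr_ge0 => i _; exact/ltW/weight_gt0.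
  have /andP[a0_le a0_gt] : a0%:R <= W * 2 ^+ lv n < a0.+1%:R.
    by apply: truncn_itv; rewrite mulr_ge0 // ltW.
  have a0_lt : a0%:R / 2 ^+ lv n < W.
    rewrite lt_neqAle ler_pdivrMr // a0_le andbT; apply/eqP => E.
    by apply: (no_dyadic a0); rewrite E.
  have a0S_gt : W < a0.+1%:R / 2 ^+ lv n by rewrite ltr_pdivlMr.
  have clo : (Wlo n c s)%:R / 2 ^+ s @[s --> \oo] --> W.
    under eq_fun do rewrite WE.
    by apply: cvg_big => [|i _]; [exact: add_continuous | exact: lo_cvg].
  have cup : (Wup n c s)%:R / 2 ^+ s @[s --> \oo] --> W.
    under eq_fun do rewrite WE.
    by apply: cvg_big => [|i _]; [exact: add_continuous | exact: up_cvg].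
  have [s [lo_s up_s]] := filter_ex
    (filterI (cvgr_gt W clo _ a0_lt) (cvgr_lt W cup _ a0S_gt)).
  exists s; rewrite /ok.
  have le_a0 : (a0 <= a n c s)%N.
    rewrite /a leq_divRL ?expn_gt0 // -(ler_nat R) !natrM !natrX.
    move: lo_s; rewrite ltr_pdivrMr // mulrAC ltr_pdivlMr ?exp2_gt0 //.
    exact: ltW.
  apply: leq_trans (_ : (a0.+1 * 2 ^ s <= _)%N); last first.
    by rewrite leq_mul2r ltnS le_a0 orbT.
  rewrite -(ltr_nat R) !natrM !natrX.
  by move: up_s; rewrite ltr_pdivrMr ?exp2_gt0 // mulrAC ltr_pdivlMr.
have [s [Ps min_s]] := ex_least ex; exists s; split=> //=.
have a_le : (a n c s)%:R / 2 ^+ lv n <= W.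
  apply: le_trans (Wlo_le s).
  rewrite ler_pdivrMr // mulrAC ler_pdivlMr ?exp2_gt0 //.
  by rewrite -!natrX -!natrM ler_nat /a leq_divM.
have a_gt : W < (a n c s).+1%:R / 2 ^+ lv n.
  apply: le_lt_trans (Wup_ge s) _.
  rewrite ltr_pdivrMr ?exp2_gt0 // mulrAC ltr_pdivlMr //.
  by rewrite -!natrX -!natrM ltr_nat.
have Z_lt_a : Z < (a n c s).+1%:R / 2 ^+ lv n.
  by rewrite ltNge; apply/negP => le_Z; apply: (no_dyadic (a n c s).+1) => //; exact: ltW.
have /andP[seg_le seg_gt] := real_set_bounds Zsum_itv (lv n).
have -> : a n c s = segment (real_set Z) (lv n).
  have iV : 0 < (2 ^+ lv n)^-1 :> R by rewrite invr_gt0.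
  apply/eqP; rewrite eqn_leq; apply/andP; split;
    rewrite -ltnS -(ltr_nat R) -(ltr_pM2r iV).
    by apply: le_lt_trans seg_gt; exact: le_trans W_le.
  exact: le_lt_trans seg_le Z_lt_a.
have := @segment_bit (real_set Z) (lv n) n; rewrite /lv subSS addKn.
by move=> ->; rewrite ?ltnS ?leq_addr.
Qed.
End Reductions.

Theorem theorem1p3 (R : realType) (U : string_pfun) (T : R) :
  optimal U -> computable_real T -> 0 < T -> T < 1 ->
  wtt_reducible (real_set (Zsum U T)) (string_set_nat (dom U)) /\
  wtt_reducible (string_set_nat (dom U)) (real_set (Zsum U T)).
Proof.
move=> optU cT T_gt0 T_lt1.
have [[/enumeration[X [rX X_mono XP X_val]] _] _] := optU.
have [lo [up [rlo rup lo_up lo_cvg up_cvg]]] := weight_bounds cT T_gt0.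
have [k kP] := weight_ge T.
split.
  exact: (Zsum_wtt_domain optU T_gt0 T_lt1 rX X_mono XP X_val rlo rup
            lo_up lo_cvg up_cvg kP).
exact: (domain_wtt_Zsum optU T_gt0 T_lt1 rX X_mono XP rlo lo_up lo_cvg kP).
Qed.
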